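(* Let $\mathsf{P}$ be a POPTA whose clock constraints (invariants and enabling conditions) are all closed (only non-strict inequalities $x \leq c$, $x \geq c$ with $c \in \mathbb{N}$, or $\mathtt{true}$) and diagonal-free (no comparisons between clocks), and which resets only clocks whose current value is non-zero. Then, for any set $O$ of observations of $\mathsf{P}$ and any $\mathit{opt} \in \{\min,\max\}$, \[ \mathit{Pr}^{\mathit{opt}}_{[\![\mathsf{P}]\!]_{\mathbb{R}}}(\mathtt{F}\, O) = \mathit{Pr}^{\mathit{opt}}_{[\![\mathsf{P}]\!]_{\mathbb{N}}}(\mathtt{F}\, O) \quad\text{and}\quad \mathbb{E}^{\mathit{opt}}_{[\![\mathsf{P}]\!]_{\mathbb{R}}}(\mathtt{F}\, O) = \mathbb{E}^{\mathit{opt}}_{[\![\mathsf{P}]\!]_{\mathbb{N}}}(\mathtt{F}\, O). \]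
   Context: A POPTA (partially observable probabilistic timed automaton) is a tuple $\mathsf{P} = (L, \overline{l}, \mathcal{X}, \mathit{Act}, \mathit{inv}, \mathit{enab}, \mathit{prob}, r, \mathcal{O}_L, \mathit{obs}_L)$: $L$ a finite set of locations with initial location $\overline{l}$; $\mathcal{X}$ a finite set of clocks; $\mathit{Act}$ a finite set of actions; $\mathit{inv}: L \to CC(\mathcal{X})$ an invariant and $\mathit{enab}: L \times \mathit{Act} \to CC(\mathcal{X})$ an enabling condition (clock constraints); $\mathit{prob}: L \times \mathit{Act} \to \mathrm{Dist}(2^{\mathcal{X}} \times L)$ a probabilistic transition function (choosing a set of clocks to reset and a target location); $r = (r_L, r_{\mathit{Act}})$ a reward structure with location reward rates $r_L : L \to \mathbb{R}_{\geq 0}$ and action rewards $r_{\mathit{Act}} : L \times \mathit{Act} \to \mathbb{R}_{\geq 0}$; $\mathcal{O}_L$ a finite set of observations and $\mathit{obs}_L : L \to \mathcal{O}_L$ a location observation function, such that locations with the same observation have identical invariants and enabling conditions, and the initial location is the only location with its observation. Clocks are always observable. For a time domain $\mathbb{T}$, the semantics $[\![\mathsf{P}]\!]_{\mathbb{T}}$ is the POMDP with states $(l,v) \in L \times \mathbb{T}^{\mathcal{X}}$ with $v \models \mathit{inv}(l)$, initial state $(\overline{l}, \mathbf{0})$, actions $\mathit{Act} \cup \mathbb{T}$, where: a time transition $a \in \mathbb{T}$ goes with probability 1 to $(l, v+a)$ provided $v+t \models \mathit{inv}(l)$ for all $0 \leq t \leq a$, with reward $r_L(l)\cdot a$; an action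 transition $a \in \mathit{Act}$ is enabled if $v \models \mathit{enab}(l,a)$ and moves to $(l',v')$ with probability $\sum_{X \subseteq \mathcal{X},\, v' = v[X:=0]} \mathit{prob}(l,a)(X,l')$, with reward $r_{\mathit{Act}}(l,a)$; and the observation of $(l,v)$ is $(\mathit{obs}_L(l), v)$. The dense-time semantics uses $\mathbb{T} = \mathbb{R}_{\geq 0}$. The digital clocks semantics uses $\mathbb{T} = \mathbb{N}$, where $v+t$ assigns $\min\{v(x)+t, \mathbf{k}_x+1\}$ to each clock $x$, with $\mathbf{k}_x$ the largest constant that $x$ is compared to in the clock constraints of $\mathsf{P}$. In a POMDP, strategies are restricted to observation-based ones (choices depend only on the sequence of observations and actions). $\mathit{Pr}^{\sigma}(\mathtt{F}\, O)$ is the probability, under strategy $\sigma$, of reaching a state whose (location) observation lies in $O$, and $\mathbb{E}^{\sigma}(\mathtt{F}\, O)$ is the expected reward accumulated until this happens; $\mathit{Pr}^{\min}, \mathit{Pr}^{\max}, \mathbb{E}^{\min}, \mathbb{E}^{\max}$ denote the infimum/supremum over all observation-based strategies. *)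

(* Defs.v *)
From HB Require Import structures.
From mathcomp Require Import all_boot all_order all_algebra.
From mathcomp Require Import all_classical all_reals all_analysis.
Set Implicit Arguments.
Unset Strict Implicit.
Unset Printing Implicit Defensive.
Import Order.TTheory GRing.Theory Num.Theory.
Import numFieldNormedType.Exports.
Local Open Scope classical_set_scope.
Local Open Scope ring_scope.

(** * POMDPs with discrete transition and choice distributions *)

(* [pomdp_avail s] is the set A(s) of actions available in [s].  The
   observation type is not required to be finite.  [pomdp_act0] only serves to
   make the type of runs inhabited. *)
Record pomdp (R : realType) := Pomdp {
  pomdp_state : choiceType;
  pomdp_act : choiceType;
  pomdp_obsT : Type;
  pomdp_init : pomdp_state;
  pomdp_act0 : pomdp_act;
  pomdp_avail : pomdp_state -> set pomdp_act;
  pomdp_trans : pomdp_state -> pomdp_act -> pomdp_state -> R;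
  pomdp_reward : pomdp_state -> pomdp_act -> R;
  pomdp_obs : pomdp_state -> pomdp_obsT;
  pomdp_trans_ge0 : forall s a s', 0 <= pomdp_trans s a s';
  pomdp_trans_sum1 : forall s a, pomdp_avail s a ->
    (\esum_(s' in setT) (pomdp_trans s a s')%:E)%E = 1%E;
  pomdp_reward_ge0 : forall s a, 0 <= pomdp_reward s a;
  pomdp_obs_avail : forall s s', pomdp_obs s = pomdp_obs s' ->
    pomdp_avail s = pomdp_avail s' }.

(* A finite path s0 -a0-> s1 -a1-> ... from the initial state is the list of
   its steps (a0, s1), (a1, s2), ... *)
Definition fpath (R : realType) (M : pomdp R) : Type :=
  seq (pomdp_act M * pomdp_state M).

Definition last_state (R : realType) (M : pomdp R) (h : fpath M) :
    pomdp_state M :=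
  last (pomdp_init M) (map snd h).

Fixpoint path_from (R : realType) (M : pomdp R) (s : pomdp_state M)
    (h : fpath M) : Prop :=
  if h is (a, s') :: h' then
    [/\ pomdp_avail s a, 0 < pomdp_trans s a s' & path_from s' h']
  else True.

Definition is_fpath (R : realType) (M : pomdp R) (h : fpath M) : Prop :=
  path_from (pomdp_init M) h.

Definition reachable (R : realType) (M : pomdp R) (s : pomdp_state M) : Prop :=
  exists2 h : fpath M, is_fpath h & last_state h = s.

(* The sequence of actions and observations along a finite path. *)
Definition trace (R : realType) (M : pomdp R) (h : fpath M) :
    seq (pomdp_act M * pomdp_obsT M) :=
  [seq (e.1, pomdp_obs e.2) | e <- h].

(* Strategies are history-dependent and randomised; only their values on
   genuine finite paths matter. *)
Definition is_strategy (R : realType) (M : pomdp R)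
    (sigma : fpath M -> pomdp_act M -> R) : Prop :=
  forall h : fpath M, is_fpath h ->
    [/\ forall a, 0 <= sigma h a,
        (\esum_(a in setT) (sigma h a)%:E)%E = 1%E
      & forall a, 0 < sigma h a -> pomdp_avail (last_state h) a].

Definition observation_based (R : realType) (M : pomdp R)
    (sigma : fpath M -> pomdp_act M -> R) : Prop :=
  forall h h' : fpath M, is_fpath h -> is_fpath h' ->
    trace h = trace h' -> sigma h = sigma h'.

Fixpoint path_weight (R : realType) (M : pomdp R)
    (sigma : fpath M -> pomdp_act M -> R) (past h : fpath M) : R :=
  if h is (a, s') :: h' then
    sigma past a * pomdp_trans (last_state past) a s'
      * path_weight sigma (rcons past (a, s')) h'
  else 1.

Definition path_prob (R : realType) (M : pomdp R)
    (sigma : fpath M -> pomdp_act M -> R) (h : fpath M) : R :=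
  path_weight sigma [::] h.

(* Infinite paths, again as sequences of steps out of the initial state.
   Sequences with an illegal step are not excluded: they form a null set for
   every measure considered below. *)
Definition run (R : realType) (M : pomdp R) : Type :=
  nat -> pomdp_act M * pomdp_state M.

HB.instance Definition _ (R : realType) (M : pomdp R) := gen_eqMixin (run M).
HB.instance Definition _ (R : realType) (M : pomdp R) :=
  gen_choiceMixin (run M).
HB.instance Definition _ (R : realType) (M : pomdp R) :=
  isPointed.Build (run M) (fun=> (pomdp_act0 M, pomdp_init M)).

Definition run_prefix (R : realType) (M : pomdp R) (w : run M) (n : nat) :
    fpath M :=
  mkseq w n.

Definition state_at (R : realType) (M : pomdp R) (w : run M) (n : nat) :
    pomdp_state M :=
  last_state (run_prefix w n).

(* All distributions being discrete, every set of prefixes of a given length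
   is an event; cylinders of single finite paths would not suffice to measure
   reachability when the state space is uncountable. *)
Definition cylinders (R : realType) (M : pomdp R) : set (set (run M)) :=
  [set C | exists (n : nat) (B : set (fpath M)),
     C = [set w : run M | B (run_prefix w n)]].

Definition run_space (R : realType) (M : pomdp R) :=
  g_sigma_algebraType (@cylinders R M).

(* The probability measure Pr^sigma on infinite paths: the one that gives the
   expected value to every cylinder. *)
Definition induced_measure (R : realType) (M : pomdp R)
    (sigma : fpath M -> pomdp_act M -> R)
    (mu : probability (run_space M) R) : Prop :=
  forall (n : nat) (B : set (fpath M)),
    mu [set w : run M | B (run_prefix w n)] =
    (\esum_(h in [set h : fpath M | size h = n /\ B h])
       (path_prob sigma h)%:E)%E.

Definition hits (R : realType) (M : pomdp R) (O : set (pomdp_obsT M))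
    (w : run M) (n : nat) : bool :=
  `[< O (pomdp_obs (state_at w n)) >].

Definition reach_event (R : realType) (M : pomdp R) (O : set (pomdp_obsT M)) :
    set (run M) :=
  [set w | exists n : nat, hits O w n].

(* Reward accumulated before the first visit to [O]; as usual for
   reachability rewards, it is infinite on runs that never visit [O]. *)
Definition reach_reward (R : realType) (M : pomdp R) (O : set (pomdp_obsT M))
    (w : run M) : \bar R :=
  if pselect (exists n : nat, hits O w n) is left ex then
    (\sum_(i < ex_minn ex) pomdp_reward (state_at w i) (w i).1)%:E
  else +oo%E.

Variant opt := Min | Max.

Definition optimum (R : realType) (o : opt) (V : set (\bar R)) : \bar R :=
  match o with Min => ereal_inf V | Max => ereal_sup V end.

Definition Pr_opt (R : realType) (o : opt) (M : pomdp R)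
    (O : set (pomdp_obsT M)) : \bar R :=
  optimum o [set p : \bar R |
    exists (sigma : fpath M -> pomdp_act M -> R)
           (mu : probability (run_space M) R),
      [/\ is_strategy sigma, observation_based sigma, induced_measure sigma mu
        & p = mu (reach_event O)]].

Definition E_opt (R : realType) (o : opt) (M : pomdp R)
    (O : set (pomdp_obsT M)) : \bar R :=
  optimum o [set e : \bar R |
    exists (sigma : fpath M -> pomdp_act M -> R)
           (mu : probability (run_space M) R),
      [/\ is_strategy sigma, observation_based sigma, induced_measure sigma mu
        & e = (\int[mu]_w reach_reward O w)%E]].

(** * Clock constraints *)

Variant cmp := CLe | CLt | CGe | CGt.

Definition cmp_eval (R : realType) (c : cmp) (x y : R) : bool :=
  match c with
  | CLe => x <= y | CLt => x < y | CGe => y <= x | CGt => y < x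
  end.

(* [CAtom x c d] is x ~ d and [CDiag x y c d] is x - y ~ d. *)
Inductive cconstr (X : finType) : Type :=
| CTrue
| CAtom of X & cmp & nat
| CDiag of X & X & cmp & nat
| CAnd of cconstr X & cconstr X.

Fixpoint sat (R : realType) (X : finType) (v : X -> R) (chi : cconstr X) :
    bool :=
  match chi with
  | CTrue => true
  | CAtom x c d => cmp_eval c (v x) d%:R
  | CDiag x y c d => cmp_eval c (v x - v y) d%:R
  | CAnd chi1 chi2 => sat v chi1 && sat v chi2
  end.

Fixpoint closed_cc (X : finType) (chi : cconstr X) : bool :=
  match chi with
  | CTrue => true
  | CAtom _ c _ | CDiag _ _ c _ =>
      match c with CLe | CGe => true | CLt | CGt => false end
  | CAnd chi1 chi2 => closed_cc chi1 && closed_cc chi2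
  end.

Fixpoint diagonal_free_cc (X : finType) (chi : cconstr X) : bool :=
  match chi with
  | CTrue | CAtom _ _ _ => true
  | CDiag _ _ _ _ => false
  | CAnd chi1 chi2 => diagonal_free_cc chi1 && diagonal_free_cc chi2
  end.

(* The largest constant [x] is compared to in [chi], 0 if there is none. *)
Fixpoint cc_max (X : finType) (x : X) (chi : cconstr X) : nat :=
  match chi with
  | CTrue => 0
  | CAtom y _ d => if y == x then d else 0
  | CDiag y z _ d => if (y == x) || (z == x) then d else 0
  | CAnd chi1 chi2 => maxn (cc_max x chi1) (cc_max x chi2)
  end.

(** * POPTAs *)

Record popta (R : realType) := Popta {
  loc : finType;
  clock : finType;
  act : finType;
  locobs : finType;
  loc0 : loc;
  inv : loc -> cconstr clock;
  enab : loc -> act -> cconstr clock;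
  prob : loc -> act -> {set clock} * loc -> R;
  rew_loc : loc -> R;
  rew_act : loc -> act -> R;
  obs : loc -> locobs;
  prob_ge0 : forall l a u, 0 <= prob l a u;
  prob_sum1 : forall l a, \sum_u prob l a u = 1;
  rew_loc_ge0 : forall l, 0 <= rew_loc l;
  rew_act_ge0 : forall l a, 0 <= rew_act l a;
  obs_inv : forall l l', obs l = obs l' -> inv l = inv l';
  obs_enab : forall l l', obs l = obs l' -> enab l = enab l';
  obs_loc0 : forall l, obs l = obs loc0 -> l = loc0 }.

Definition max_const (R : realType) (P : popta R) (x : clock P) : nat :=
  maxn (\max_(l : loc P) cc_max x (inv l))
       (\max_(l : loc P) \max_(a : act P) cc_max x (enab l a)).

(* A time domain T for a set of clocks: its elements, their value as real
   numbers, and the delay operation v + t on clock valuations. *)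
Record time_domain (R : realType) (X : finType) := TimeDomain {
  time : choiceType;
  time0 : time;
  dur : time -> R;
  delay : {ffun X -> time} -> time -> {ffun X -> time};
  dur_ge0 : forall t, 0 <= dur t }.

Section semantics.
Variables (R : realType) (P : popta R) (T : time_domain R (clock P)).

Definition vsat (v : {ffun clock P -> time T}) (chi : cconstr (clock P)) :
    bool :=
  sat (fun x => dur (v x)) chi.

Definition reset (v : {ffun clock P -> time T}) (Y : {set clock P}) :
    {ffun clock P -> time T} :=
  [ffun x => if x \in Y then time0 T else v x].

Definition sem_state : choiceType := (loc P * {ffun clock P -> time T})%type.
Definition sem_act : choiceType := (act P + time T)%type.

Definition sem_avail (s : sem_state) : set sem_act :=
  [set b | match b with
           | inl a => vsat s.2 (enab s.1 a) : Prop
           | inr a => forall t : time T, dur t <= dur a ->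
                        vsat (delay s.2 t) (inv s.1)
           end].

Definition sem_trans (s : sem_state) (b : sem_act) (s' : sem_state) : R :=
  match b with
  | inl a => \sum_(Y : {set clock P} | s'.2 == reset s.2 Y)
               prob s.1 a (Y, s'.1)
  | inr a => if s' == (s.1, delay s.2 a) then 1 else 0
  end.

Definition sem_reward (s : sem_state) (b : sem_act) : R :=
  match b with
  | inl a => rew_act s.1 a
  | inr a => rew_loc s.1 * dur a
  end.

Definition sem_obs (s : sem_state) : locobs P * {ffun clock P -> time T} :=
  (obs s.1, s.2).

Lemma sem_trans_ge0 s b s' : 0 <= sem_trans s b s'.
Proof.
case: b => [a|a] /=; last by case: ifP.
by apply: sumr_ge0 => Y _; exact: prob_ge0.
Qed.

Lemma esum_point (S : choiceType) (s0 : S) (c : R) : 0 <= c ->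
  (\esum_(s in setT) (if s == s0 then c else 0)%:E)%E = c%:E.
Proof.
move=> c0; rewrite (esumID [set s0]); last by move=> i _; case: ifP.
rewrite setTI esum_set1 ?eqxx// esum1 ?adde0//.
by move=> s [_ /eqP/negbTE ->].
Qed.

Lemma sem_trans_sum1 s b : sem_avail s b ->
  (\esum_(s' in setT) (sem_trans s b s')%:E)%E = 1%E.
Proof.
move=> _; case: b => [a|a] /=; last exact: esum_point.
transitivity (\esum_(s' in [set: sem_state])
   \sum_(u : {set clock P} * loc P)
     (if s' == (u.2, reset s.2 u.1) then prob s.1 a u else 0)%:E)%E.
  apply: eq_esum => s' _; rewrite sumEFin; congr EFin.
  transitivity (\sum_(Y : {set clock P}) \sum_(l : loc P)
      if s' == (l, reset s.2 Y) then prob s.1 a (Y, l) else 0); last first.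
    by rewrite pair_bigA /=; apply: eq_bigr => -[].
  rewrite big_mkcond; apply: eq_bigr => Y _.
  rewrite (bigD1 s'.1)//= big1 ?addr0; last first.
    by move=> l /negbTE ne; case: ifP => // /eqP e; rewrite e eqxx in ne.
  by case: s' => l v /=; rewrite xpair_eqE eqxx.
rewrite esum_sum; last first.
  by move=> s' u _ _; rewrite lee_fin; case: ifP => // _; exact: prob_ge0.
under eq_bigr do rewrite esum_point ?prob_ge0//.
by rewrite sumEFin prob_sum1.
Qed.

Lemma sem_reward_ge0 s b : 0 <= sem_reward s b.
Proof.
case: b => [a|a] /=; first exact: rew_act_ge0.
by apply: mulr_ge0; [exact: rew_loc_ge0|exact: dur_ge0].
Qed.

Lemma sem_obs_avail s s' : sem_obs s = sem_obs s' ->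
  sem_avail s = sem_avail s'.
Proof.
case: s s' => [l v] [l' v'] [] /= ol <-.
by rewrite /sem_avail /= (obs_inv ol) (obs_enab ol).
Qed.

(* Pairs (l, v) violating inv(l) are not excluded from the state type; that
   they cannot be reached is what [well_formed] below requires. *)
Definition sem : pomdp R :=
  @Pomdp R sem_state sem_act (locobs P * {ffun clock P -> time T})%type
    (loc0 P, [ffun=> time0 T]) (inr (time0 T))
    sem_avail sem_trans sem_reward sem_obs
    sem_trans_ge0 sem_trans_sum1 sem_reward_ge0 sem_obs_avail.

Definition obs_target (O : {set locobs P}) : set (pomdp_obsT sem) :=
  [set o | o.1 \in O].

End semantics.

Definition real_time (R : realType) (X : finType) : time_domain R X :=
  @TimeDomain R X {nonneg R} 0%:nng (fun t => t%:num)
    (fun v t => [ffun x => ((v x)%:num + t%:num)%:nng])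
    (fun t => ge0 t).

Definition digital_time (R : realType) (P : popta R) :
    time_domain R (clock P) :=
  @TimeDomain R (clock P) nat 0%N (fun t => t%:R)
    (fun v t => [ffun x => minn (v x + t) (max_const x).+1])
    (fun t => ler0n R t).

Definition sem_R (R : realType) (P : popta R) : pomdp R :=
  sem (real_time R (clock P)).

Definition sem_N (R : realType) (P : popta R) : pomdp R :=
  sem (digital_time P).

Definition closed_popta (R : realType) (P : popta R) : Prop :=
  (forall l : loc P, closed_cc (inv l)) /\
  (forall (l : loc P) (a : act P), closed_cc (enab l a)).

Definition diagonal_free (R : realType) (P : popta R) : Prop :=
  (forall l : loc P, diagonal_free_cc (inv l)) /\
  (forall (l : loc P) (a : act P), diagonal_free_cc (enab l a)).

(* The transitions of the dense-time semantics stay within its state space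
   {(l, v) | v |= inv(l)}, which includes the initial state. *)
Definition well_formed (R : realType) (P : popta R) : Prop :=
  forall (l : loc P) (v : {ffun clock P -> {nonneg R}}),
    @reachable R (sem_R P) (l, v) ->
    sat (fun x => (v x)%:num) (inv l).

Definition resets_nonzero (R : realType) (P : popta R) : Prop :=
  forall (l : loc P) (v : {ffun clock P -> {nonneg R}}) (a : act P)
         (Y : {set clock P}) (l' : loc P) (x : clock P),
    @reachable R (sem_R P) (l, v) ->
    sat (fun y => (v y)%:num) (enab l a) ->
    0 < prob l a (Y, l') -> x \in Y -> (v x)%:num != 0.

(* Main.v *)
From mathcomp Require Import all_boot all_order all_algebra.
From mathcomp Require Import all_classical all_reals all_analysis.
From mathcomp Require Import measurable_realfun zify lra.
Require Import Defs.
Set Implicit Arguments.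
Unset Strict Implicit.
Unset Printing Implicit Defensive.
Import Order.TTheory GRing.Theory Num.Theory.
Import numFieldNormedType.Exports.
Local Open Scope classical_set_scope.
Local Open Scope ring_scope.

(** A run of one semantics is retimed into a run of the other one by changing
    only its delays and the resulting clock values. Since every clock that is
    reset is nonzero, the reset set can be read off the valuations, so retiming
    maps the transition probabilities of the source to those of the target.
    Given an observation-based strategy in the source, let the target strategy
    play the conditional distribution of the next retimed action given the
    retimed path. The source paths over two target paths with the same trace
    are in trace-preserving bijection, and their probabilities differ by a
    constant factor coming from the transitions alone; hence the target
    strategy is observation-based, and the measure it induces is the image of
    the source measure.

    A digital run is also a dense run with integral delays, and this changes
    neither the observations nor the rewards. In the other direction, for
    [u] in [0, 1[ every absolute time [t] is replaced by the integral part of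
    [t + u]; this preserves closed diagonal-free constraints. The targets
    visited are unchanged, so the reachability probabilities agree exactly.
    As the integral part of [t + u] has mean [t] for uniform [u], the expected
    reward of a dense strategy is, by Tonelli, the mean over [u] of the rewards
    of its digitizations, so it lies between their infimum and supremum. *)

(** * Sums of nonnegative families over arbitrary index sets *)

Section esum_extra.
Local Open Scope ereal_scope.
Variable R : realType.

Lemma esumZl (T : choiceType) (I : set T) (f : T -> \bar R) (c : R) :
  (0 <= c)%R -> (forall i, 0 <= f i) ->
  \esum_(i in I) (c%:E * f i) = c%:E * \esum_(i in I) f i.
Proof.
have le (k : R) (g : T -> \bar R) : (0 <= k)%R -> (forall i, 0 <= g i) ->
    \esum_(i in I) (k%:E * g i) <= k%:E * \esum_(i in I) g i.
  move=> k0 g0; apply: ge_ereal_sup => _ [X [fX XI] <-].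
  rewrite -ge0_mule_fsumr//.
  by apply: lee_wpmul2l; rewrite ?lee_fin//; apply: esum_ge; exists X.
move=> c0 f0; apply/eqP; rewrite eq_le le//=.
have [->|cN0] := eqVneq c 0%R.
  by rewrite mul0e; apply: esum_ge0 => i _; rewrite mul0e.
have {c0 cN0} c0 : (0 < c)%R by rewrite lt_def cN0.
(* The reverse inequality is the first one applied to the factor [c^-1]. *)
rewrite -lee_pdivlMl//.
apply: le_trans (le c^-1%R (fun i => c%:E * f i) _ _); last 2 first.
- by rewrite invr_ge0 ltW.
- by move=> i; rewrite mule_ge0 ?f0// lee_fin ltW.
by apply: le_esum => i _; rewrite muleA -EFinM mulVf ?gt_eqF// mul1e.
Qed.

Lemma le_esum_subset (T : choiceType) (I J : set T) (f : T -> \bar R) :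
  I `<=` J -> (forall i, J i -> 0 <= f i) ->
  \esum_(i in I) f i <= \esum_(i in J) f i.
Proof.
move=> IJ f0; rewrite [leRHS](esumID I)// (setIidr IJ) leeDl//.
by apply: esum_ge0 => i [/f0].
Qed.

Lemma exchange_esum (T1 T2 : choiceType) (I : set T1) (J : set T2)
    (f : T1 -> T2 -> \bar R) :
  (forall i j, 0 <= f i j) ->
  \esum_(i in I) \esum_(j in J) f i j = \esum_(j in J) \esum_(i in I) f i j.
Proof.
move=> f0; rewrite !esum_esum//.
rewrite (reindex_esum (J `*`` fun=> I) _ (fun x => (x.2, x.1)))//; split=> //=.
- by move=> [i j] [].
- by move=> [i j] [i' j'] /= _ _ [-> ->].
- by move=> [i j] [/= Ii Jj]; exists (j, i).
Qed.

Lemma esum_fibres (T1 T2 : choiceType) (I : set T1) (J : set T2) (g : T1 -> T2)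
    (f : T1 -> \bar R) :
  (forall i, 0 <= f i) -> (forall i, I i -> J (g i)) ->
  \esum_(i in I) f i = \esum_(j in J) \esum_(i in I `&` [set i | g i = j]) f i.
Proof.
move=> f0 IJ; rewrite esum_esum//.
rewrite (reindex_esum I _ (fun i => (g i, i)))//; split=> //=.
- by move=> i Ii; split => //=; exact: IJ.
- by move=> i i' _ _ [].
- by move=> [j i] [/= Jj [Ii <-]]; exists i.
Qed.

End esum_extra.

(** * Finite paths and their probabilities *)

Section paths.
Variables (R : realType) (M : pomdp R).
Implicit Types (sigma : fpath M -> pomdp_act M -> R) (g h : fpath M).

Lemma last_state_rcons g e : last_state (rcons g e) = e.2.
Proof. by rewrite /last_state map_rcons last_rcons. Qed.

Lemma trace_rcons g e :
  trace (rcons g e) = rcons (trace g) (e.1, pomdp_obs e.2).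
Proof. by rewrite /trace map_rcons. Qed.

Lemma trace_last g h : trace g = trace h ->
  pomdp_obs (last_state g) = pomdp_obs (last_state h).
Proof.
elim/last_ind: g h => [|g e _] h; elim/last_ind: h => [|h f _] //.
- by rewrite trace_rcons => /(congr1 size); rewrite size_rcons.
- by rewrite trace_rcons => /(congr1 size); rewrite size_rcons.
- by rewrite !trace_rcons !last_state_rcons => /rcons_inj[_ _ ->].
Qed.

Lemma path_from_rcons s g e : path_from s (rcons g e) <->
  [/\ path_from s g, pomdp_avail (last s (map snd g)) e.1
    & 0 < pomdp_trans (last s (map snd g)) e.1 e.2].
Proof.
elim: g s e => [|[a t] g IH] s [b u] /=; first by split=> -[].
split.
  by move=> [? ? /IH[/= ? ? ?]].
by move=> [[? ? ?] ? ?]; split=> //; apply/IH.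
Qed.

Lemma is_fpath_rcons g e : is_fpath (rcons g e) <->
  [/\ is_fpath g, pomdp_avail (last_state g) e.1
    & 0 < pomdp_trans (last_state g) e.1 e.2].
Proof. exact: path_from_rcons. Qed.

Lemma path_weight_rcons sigma past g e :
  path_weight sigma past (rcons g e) = path_weight sigma past g *
   (sigma (past ++ g) e.1 * pomdp_trans (last_state (past ++ g)) e.1 e.2).
Proof.
elim: g past => [|[a t] g IH] past /=.
  by case: e => a t /=; rewrite cats0 mulr1 mul1r.
by rewrite IH -cats1 -catA /= mulrA.
Qed.

Lemma path_prob_rcons sigma g e : path_prob sigma (rcons g e) =
  path_prob sigma g * (sigma g e.1 * pomdp_trans (last_state g) e.1 e.2).
Proof. by rewrite /path_prob path_weight_rcons. Qed.

(** Off genuine paths [sigma] is unconstrained and may be negative, so nonnegativity relies on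
    illegal prefixes having probability zero; hence one induction for both claims. *)
Lemma path_prob_ge0 sigma g : is_strategy sigma -> 0 <= path_prob sigma g /\
  (~ is_fpath g -> path_prob sigma g = 0).
Proof.
move=> st; elim/last_ind: g => [|g [a s] [IH0 IH]].
  by split; [exact: ler01|move=> /(_ I)].
rewrite path_prob_rcons/=.
case: (pselect (is_fpath g)) => [fg|/IH ->]; last first.
  by rewrite mul0r.
have [sg _ av] := st _ fg; split.
  by rewrite !mulr_ge0// pomdp_trans_ge0.
move=> nf; have [s0|] := ltrP 0 (sigma g a); last first.
  by move=> s0; rewrite (@le_anti _ _ (sigma g a) 0) ?s0 ?sg// mul0r mulr0.
have [t0|t0] := ltrP 0 (pomdp_trans (last_state g) a s).
  by case: nf; apply/is_fpath_rcons; split => //; exact: av.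
rewrite [X in _ * X](@le_anti _ _ _ 0) ?mulr0//.
by rewrite mulr_ge0 ?sg ?pomdp_trans_ge0// andbT mulr_ge0_le0.
Qed.

End paths.

(** * Images of strategies *)

Lemma pushforward_probability d d' (T : measurableType d)
    (T' : measurableType d') (R : realType) (P : probability T R) (f : T -> T') :
  measurable_fun [set: T] f ->
  exists P' : probability T' R, (forall A, P' A = P (f @^-1` A)) /\
    forall g : T' -> \bar R, measurable_fun [set: T'] g ->
      (forall x, 0 <= g x)%E ->
      (\int[P']_x g x = \int[P]_x g (f x))%E.
Proof.
move=> mf; pose X : {mfun T >-> T'} := mfun_Sub (mem_set mf).
exists (distribution P X); split=> // g mg g0.
exact: (@ge0_integral_distribution _ _ _ _ _ P X).
Qed.

Section runs.
Variables (R : realType) (M : pomdp R).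
Implicit Types (w : run M) (n : nat).

Lemma run_prefixS w n : run_prefix w n.+1 = rcons (run_prefix w n) (w n).
Proof. exact: mkseqS. Qed.

Lemma measurable_prefix_set (B : set (fpath M)) n :
  measurable ([set w | B (run_prefix w n)] : set (run_space M)).
Proof. by apply: sub_gen_smallest; exists n, B. Qed.

End runs.

Section transfer.
Variables (R : realType) (M M' : pomdp R).
Variable alpha : fpath M -> pomdp_act M -> pomdp_act M'.
Variable beta : fpath M -> fpath M' -> pomdp_act M * pomdp_state M ->
  pomdp_state M'.

(** The fold carries the source path beside its image because [alpha] and [beta] depend on the
    source history. *)
Definition image_step (p : fpath M * fpath M')
    (e : pomdp_act M * pomdp_state M) : fpath M * fpath M' :=
  (rcons p.1 e, rcons p.2 (alpha p.1 e.1, beta p.1 p.2 e)).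

Definition image_path (g : fpath M) : fpath M' :=
  (foldl image_step ([::], [::]) g).2.

Definition image_run (w : run M) : run M' := fun n =>
  let g := run_prefix w n in
  (alpha g (w n).1, beta g (image_path g) (w n)).

Lemma image_path_rcons g e : image_path (rcons g e) =
  rcons (image_path g) (alpha g e.1, beta g (image_path g) e).
Proof.
suff H : (foldl image_step ([::], [::]) g).1 = g.
  by rewrite /image_path foldl_rcons /= H.
by elim/last_ind: g => // g f IH; rewrite foldl_rcons/= IH.
Qed.

Lemma size_image_path g : size (image_path g) = size g.
Proof.
by elim/last_ind: g => // g e IH; rewrite image_path_rcons !size_rcons IH.
Qed.

Lemma run_prefix_image_run w n :
  run_prefix (image_run w) n = image_path (run_prefix w n).
Proof. by elim: n => // n IH; rewrite !run_prefixS IH image_path_rcons. Qed.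

Lemma measurable_image_run :
  measurable_fun [set: run_space M] (image_run : run_space M -> run_space M').
Proof.
apply: (@measurability _ _ (run_space M) (run_space M') setT image_run
  (@cylinders R M')) => //.
move=> _ [_ [n [B ->]] <-]; rewrite setTI.
have -> : image_run @^-1` [set w | B (run_prefix w n)] =
    [set w | (image_path @^-1` B) (run_prefix w n)].
  by apply/seteqP; split=> w; rewrite /preimage/= run_prefix_image_run.
exact: measurable_prefix_set.
Qed.

(** [trans_lump] serves to compute the image measure. The image strategy is observation-based thanks
    to [trans_step], which preserves products of transition probabilities, and to [trans_lift] and
    [beta_inj], which match the source paths over image paths of equal trace. *)
Hypothesis alpha_trace : forall g1 g2, trace g1 = trace g2 ->
  alpha g1 = alpha g2.
Hypothesis alpha_avail : forall g a, is_fpath g ->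
  pomdp_avail (last_state g) a ->
  pomdp_avail (last_state (image_path g)) (alpha g a).
Hypothesis trans_lump : forall g a s', is_fpath g ->
  pomdp_avail (last_state g) a ->
  (\esum_(s in [set s | beta g (image_path g) (a, s) = s'])
     (pomdp_trans (last_state g) a s)%:E)%E =
  (pomdp_trans (last_state (image_path g)) (alpha g a) s')%:E.
Hypothesis trans_step : forall g a s, is_fpath g ->
  pomdp_avail (last_state g) a -> 0 < pomdp_trans (last_state g) a s ->
  pomdp_trans (last_state (image_path g)) (alpha g a)
    (beta g (image_path g) (a, s)) = pomdp_trans (last_state g) a s.
Hypothesis trans_lift : forall g1 g2 a s s', is_fpath g1 -> is_fpath g2 ->
  trace g1 = trace g2 -> trace (image_path g1) = trace (image_path g2) ->
  pomdp_avail (last_state g1) a -> 0 < pomdp_trans (last_state g1) a s ->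
  0 < pomdp_trans (last_state (image_path g2)) (alpha g2 a) s' ->
  pomdp_obs (beta g1 (image_path g1) (a, s)) = pomdp_obs s' ->
  exists s2, [/\ pomdp_obs s2 = pomdp_obs s,
    0 < pomdp_trans (last_state g2) a s2 & beta g2 (image_path g2) (a, s2) = s'].
Hypothesis beta_inj : forall g h a s1 s2,
  beta g h (a, s1) = beta g h (a, s2) -> pomdp_obs s1 = pomdp_obs s2 -> s1 = s2.
Variable a0 : pomdp_act M'.
Hypothesis a0_avail : forall h, is_fpath h -> pomdp_avail (last_state h) a0.

(* The product of the transition probabilities alone. *)
Definition fpath_prob (N : pomdp R) (g : fpath N) : R :=
  path_prob (fun _ _ => 1) g.

Lemma fpath_prob_gt0 (N : pomdp R) (g : fpath N) :
  is_fpath g -> 0 < fpath_prob g.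
Proof.
elim/last_ind: g => [|g e IH]; first by rewrite ltr01.
move=> /is_fpath_rcons[fg _ t]; rewrite /fpath_prob path_prob_rcons mul1r.
by rewrite mulr_gt0 ?IH.
Qed.

Lemma fpath_prob_image g : is_fpath g -> fpath_prob (image_path g) = fpath_prob g.
Proof.
elim/last_ind: g => // g [a s] IH /is_fpath_rcons[/= fg ag tg].
rewrite image_path_rcons /fpath_prob !path_prob_rcons !mul1r/=.
by rewrite -!/(fpath_prob _) IH// trans_step.
Qed.

(** The existence half of the bijection between the fibres over two image paths with the same trace,
    built step by step with [trans_lift]. *)
Lemma image_path_lift g1 h2 : is_fpath g1 -> is_fpath h2 ->
  trace (image_path g1) = trace h2 ->
  exists g2, [/\ is_fpath g2, image_path g2 = h2 & trace g2 = trace g1].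
Proof.
elim/last_ind: g1 h2 => [|g1 [a s] IH] h2.
  by move=> _ _ /=; case: h2 => // _; exists [::].
move=> /is_fpath_rcons[/= fg ag tg]; rewrite image_path_rcons.
elim/last_ind: h2 => [|h2 [a' s'] _].
  by rewrite trace_rcons => _ /(congr1 size); rewrite size_rcons.
move=> /is_fpath_rcons[/= fh ah th]; rewrite !trace_rcons/=.
move=> /rcons_inj[e ea es]; have [g2 [fg2 hg2 e2]] := IH _ fg fh e.
have ea2 : alpha g2 a = a' by rewrite -ea (alpha_trace e2).
have [||s2 [os2 ts2 bs2]] := trans_lift fg fg2 (esym e2) _ ag tg _ es.
- by rewrite hg2.
- by rewrite hg2 ea2.
exists (rcons g2 (a, s2)); split.
- apply/is_fpath_rcons; split => //=.
  by rewrite (pomdp_obs_avail (trace_last e2)).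
- by rewrite image_path_rcons/= ea2 bs2 hg2.
- by rewrite !trace_rcons/= e2 os2.
Qed.

(** The uniqueness half: inside a fibre, [beta_inj] recovers each state from its image and its
    observation. *)
Lemma image_path_inj g1 g2 : trace g1 = trace g2 ->
  image_path g1 = image_path g2 -> g1 = g2.
Proof.
elim/last_ind: g1 g2 => [|g1 [a1 s1] IH] g2.
  by case: g2.
elim/last_ind: g2 => [|g2 [a2 s2] _].
  by rewrite trace_rcons => /(congr1 size); rewrite size_rcons.
rewrite !trace_rcons/= !image_path_rcons => /rcons_inj[et -> eo] /rcons_inj[em _].
by rewrite -(IH _ et em) => /beta_inj ->.
Qed.

Variable sigma : fpath M -> pomdp_act M -> R.
Hypothesis sigma_strat : is_strategy sigma.
Hypothesis sigma_obs : observation_based sigma.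

Let P_ge0 g : 0 <= path_prob sigma g.
Proof. by have [] := path_prob_ge0 g sigma_strat. Qed.

Let P_eq0 g : ~ is_fpath g -> path_prob sigma g = 0.
Proof. by have [] := path_prob_ge0 g sigma_strat. Qed.

Let Psigma_ge0 g a : 0 <= path_prob sigma g * sigma g a.
Proof.
case: (pselect (is_fpath g)) => [fg|/P_eq0 ->]; last by rewrite mul0r.
by rewrite mulr_ge0//; have [] := sigma_strat fg.
Qed.

Definition image_prob (h : fpath M') : \bar R :=
  (\esum_(g in [set g : fpath M | is_fpath g /\ image_path g = h])
    (path_prob sigma g)%:E)%E.

(** The joint probability of the image path and the next image action; the inner sum is there
    because several source actions, such as delays rounded alike, may share an image. *)
Definition image_act_prob (h : fpath M') (a' : pomdp_act M') : \bar R :=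
  (\esum_(g in [set g : fpath M | is_fpath g /\ image_path g = h])
     \esum_(a in [set a | alpha g a = a'])
       (path_prob sigma g * sigma g a)%:E)%E.

(* The conditional probability of the next image action given the image
   path; [a0] is played after image paths of probability zero. *)
Definition image_strategy (h : fpath M') (a' : pomdp_act M') : R :=
  if image_prob h == 0%E then if a' == a0 then 1 else 0
  else fine (image_act_prob h a') / fine (image_prob h).

Lemma strategy_esum g : is_fpath g ->
  (\esum_(a in setT) (path_prob sigma g * sigma g a)%:E)%E =
  (path_prob sigma g)%:E.
Proof.
move=> fg; have [s0 s1 _] := sigma_strat fg.
under eq_esum do rewrite EFinM.
by rewrite esumZl// s1 mule1.
Qed.

Lemma image_prob_ge0 h : (0 <= image_prob h)%E.
Proof. by apply: esum_ge0 => g _; rewrite lee_fin. Qed.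

Lemma image_act_prob_ge0 h a' : (0 <= image_act_prob h a')%E.
Proof. by apply: esum_ge0 => g _; apply: esum_ge0 => a _; rewrite lee_fin. Qed.

Lemma image_act_prob_esum h :
  (\esum_(a' in setT) image_act_prob h a')%E = image_prob h.
Proof.
rewrite /image_act_prob exchange_esum; last first.
  by move=> a' g; apply: esum_ge0 => a _; rewrite lee_fin.
apply: eq_esum => g [fg _]; rewrite -strategy_esum//.
rewrite [RHS](esum_fibres (J := setT) (g := alpha g))//; last first.
  by move=> a; rewrite lee_fin.
by apply: eq_esum => a' _; rewrite setTI.
Qed.

Lemma image_act_prob_le h a' : (image_act_prob h a' <= image_prob h)%E.
Proof.
rewrite -image_act_prob_esum -[leLHS](@esum_set1 _ _ a' (image_act_prob h)).
  by apply: le_esum_subset => // i _; exact: image_act_prob_ge0.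
exact: image_act_prob_ge0.
Qed.

Lemma esum_fibre_rcons (h : fpath M') a' s' :
  image_prob (rcons h (a', s')) = (\esum_(g in [set g | image_path g = h])
    \esum_(a in [set a | alpha g a = a'])
    \esum_(s in [set s | beta g h (a, s) = s'])
    (path_prob sigma g * (sigma g a * pomdp_trans (last_state g) a s))%:E)%E.
Proof.
have H0 g a s : 0 <=
    path_prob sigma g * (sigma g a * pomdp_trans (last_state g) a s).
  by rewrite mulrA mulr_ge0// pomdp_trans_ge0.
transitivity (\esum_(g in [set g | image_path g = rcons h (a', s')])
    (path_prob sigma g)%:E)%E.
  rewrite /image_prob esum_mkcond [RHS]esum_mkcond; apply: eq_esum => g _.
  case: ifPn => [/set_mem/= [_ hg]|].
    by rewrite ifT// inE.
  rewrite notin_setE/= => /not_andP[nf|nh]; first by rewrite P_eq0//; case: ifP.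
  by rewrite memNset.
under [RHS]eq_esum => g _.
  rewrite esum_esum; last by move=> *; rewrite lee_fin.
  over.
rewrite esum_esum; last by move=> *; rewrite lee_fin.
set K := (X in _ = (\esum_(k in X) _)%E).
rewrite (reindex_esum K _ (fun k => rcons k.1 k.2)).
  by apply: eq_esum => -[g [a s]] _ /=; rewrite path_prob_rcons.
split.
- move=> [g [a s]] [/= <- [/= <- <-]].
  by rewrite image_path_rcons.
- by move=> [g [a s]] [g' [b t]] _ _ /= /rcons_inj[-> -> ->].
- move=> g; elim/last_ind: g => [|g [a s] _] /=.
    by move=> /(congr1 size); rewrite size_rcons.
  rewrite image_path_rcons => /rcons_inj[e1 e2 e3].
  exists (g, (a, s)) => //; split => //=; split => //=.
  by rewrite -e1.
Qed.

(** By lumping, the probability of moving into the fibre of [s'] depends on the image path only and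
    factors out of the sum. *)
Lemma image_prob_rcons (h : fpath M') a' s' :
  image_prob (rcons h (a', s')) =
  ((pomdp_trans (last_state h) a' s')%:E * image_act_prob h a')%E.
Proof.
rewrite esum_fibre_rcons.
transitivity (\esum_(g in [set g : fpath M | is_fpath g /\ image_path g = h])
    ((pomdp_trans (last_state h) a' s')%:E *
     \esum_(a in [set a | alpha g a = a'])
       (path_prob sigma g * sigma g a)%:E))%E; last first.
  rewrite esumZl ?pomdp_trans_ge0// => g.
  by apply: esum_ge0 => a _; rewrite lee_fin.
rewrite esum_mkcond [RHS]esum_mkcond; apply: eq_esum => g _.
case: ifPn => [/set_mem/= hg|]; last first.
  by rewrite notin_setE/= => nh; rewrite memNset//= => -[].
case: (pselect (is_fpath g)) => [fg|nf]; last first.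
  rewrite memNset/=; last by case.
  by rewrite esum1// => a _; rewrite esum1// => s _; rewrite P_eq0 ?mul0r.
rewrite ifT ?inE// -esumZl; last 2 first.
- exact: pomdp_trans_ge0.
- by move=> a; rewrite lee_fin.
apply: eq_esum => a /= aa'.
have [sg0 _ sgav] := sigma_strat fg.
transitivity (\esum_(s in [set s | beta g h (a, s) = s'])
    ((path_prob sigma g * sigma g a)%:E *
     (pomdp_trans (last_state g) a s)%:E))%E.
  by apply: eq_esum => s _; rewrite -EFinM mulrA.
rewrite esumZl//; last by move=> s; rewrite lee_fin pomdp_trans_ge0.
rewrite [RHS]muleC.
(* [trans_lump] asks for [a] to be available; an action that [sigma] never plays contributes zero to
   both sides. *)
have := sg0 a; rewrite le_eqVlt => /orP[/eqP <-|/sgav av].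
  by rewrite mulr0 !mul0e.
by congr (_ * _)%E; rewrite -hg -aa' trans_lump.
Qed.

Variable mu : probability (run_space M) R.
Hypothesis mu_sigma : induced_measure sigma mu.

(** All paths in the fibre have the length of [h], and the paths of one length carry the total mass
    of [mu]. *)
Lemma image_prob_le1 h : (image_prob h <= 1)%E.
Proof.
have -> : (1 = mu setT)%E by rewrite probability_setT.
have -> : setT = [set w : run_space M | setT (run_prefix w (size h))] by [].
rewrite mu_sigma; apply: le_esum_subset => [g [fg <-] /=|g _].
  by rewrite size_image_path.
by rewrite lee_fin.
Qed.

Lemma image_prob_fin h : image_prob h \is a fin_num.
Proof.
by rewrite ge0_fin_numE ?image_prob_ge0// (le_lt_trans (image_prob_le1 h)) ?ltry.
Qed.

Lemma image_act_prob_fin h a' : image_act_prob h a' \is a fin_num.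
Proof.
rewrite ge0_fin_numE ?image_act_prob_ge0//.
rewrite (le_lt_trans (image_act_prob_le _ _))//.
by rewrite -ge0_fin_numE ?image_prob_ge0 ?image_prob_fin.
Qed.

Lemma image_strategy_ge0 h a' : 0 <= image_strategy h a'.
Proof.
rewrite /image_strategy; case: ifP => _; first by case: ifP.
by rewrite divr_ge0// fine_ge0// (image_act_prob_ge0, image_prob_ge0).
Qed.

(** The chain rule for conditional probabilities. After an image path of probability zero the joint
    probability vanishes as well, so the default choice is harmless. *)
Lemma path_prob_image h : (path_prob image_strategy h)%:E = image_prob h.
Proof.
elim/last_ind: h => [|h [a' s'] IH].
  rewrite /image_prob /path_prob/=.
  rewrite (_ : [set _ | _] = [set [::]]) ?esum_set1//.
  apply/seteqP; split=> g /=; last by move=> ->.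
  by move=> [_ /(congr1 size)]; rewrite size_image_path => /size0nil.
rewrite path_prob_rcons/= mulrC EFinM IH image_prob_rcons.
rewrite mulrC EFinM -muleA; congr (_ * _)%E.
rewrite /image_strategy; case: eqP => [Q0|/eqP Q0].
  rewrite Q0 mule0; apply/esym/eqP.
  by rewrite eq_le image_act_prob_ge0 andbT -Q0 image_act_prob_le.
rewrite -[X in (_ * X)%E]fineK ?image_prob_fin// -EFinM divfK ?fineK//.
  exact: image_act_prob_fin.
by rewrite fine_eq0// image_prob_fin.
Qed.

Lemma image_is_strategy : is_strategy image_strategy.
Proof.
move=> h fh; split; first exact: image_strategy_ge0.
  rewrite /image_strategy; case: eqP => [Q0|/eqP Q0]; first exact: esum_point.
  under eq_esum => a' _.
    rewrite mulrC EFinM fineK; last exact: image_act_prob_fin.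
    over.
  rewrite esumZl; first last.
  - by move=> a'; exact: image_act_prob_ge0.
  - by rewrite invr_ge0 fine_ge0// image_prob_ge0.
  rewrite image_act_prob_esum -[X in (_ * X)%E]fineK ?image_prob_fin//.
  by rewrite -EFinM mulVf// fine_eq0// image_prob_fin.
move=> a'; rewrite /image_strategy; case: eqP => [Q0|/eqP Q0].
  by case: eqP => [-> _|_]; [exact: a0_avail|rewrite ltxx].
move=> lt0; apply: contrapT => nav; move: lt0.
(* By [alpha_avail], a source action played with positive probability has an available image, so
   none contributes to [a']. *)
rewrite (_ : image_act_prob h a' = 0%E) ?mul0r ?ltxx//.
rewrite /image_act_prob esum1// => g [fg hg]; apply: esum1 => a /= aa'.
have [sg0 _ sgav] := sigma_strat fg.
have := sg0 a; rewrite le_eqVlt => /orP[/eqP <-|/sgav av].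
  by rewrite mulr0.
by case: nav; rewrite -hg -aa'; exact: alpha_avail.
Qed.

(* Observationally equivalent paths see the same choices of [sigma], so their
   probabilities are proportional to those of their transitions. *)
Lemma path_prob_obs g1 g2 : is_fpath g1 -> is_fpath g2 ->
  trace g1 = trace g2 ->
  path_prob sigma g1 * fpath_prob g2 = path_prob sigma g2 * fpath_prob g1.
Proof.
elim/last_ind: g1 g2 => [|g1 [a1 s1] IH] g2.
  by case: g2.
elim/last_ind: g2 => [|g2 [a2 s2] _].
  by rewrite trace_rcons => _ _ /(congr1 size); rewrite size_rcons.
move=> /is_fpath_rcons[/= f1 _ _] /is_fpath_rcons[/= f2 _ _].
rewrite !trace_rcons/= => /rcons_inj[et -> _].
rewrite /fpath_prob !path_prob_rcons/= -!/(fpath_prob _) !mul1r.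
rewrite (sigma_obs f1 f2 et).
rewrite [LHS]mulrACA (IH _ f1 f2 et) [RHS]mulrACA.
by congr (_ * _); rewrite mulrAC.
Qed.

(** Sums up a proportionality along the bijection between two fibres. It is used for both the
    numerator and the denominator of the conditional probability, and is cross-multiplied to avoid
    dividing extended reals. *)
Lemma esum_fibre_obs (F : fpath M -> \bar R) h1 h2 :
  is_fpath h1 -> is_fpath h2 -> trace h1 = trace h2 ->
  (forall g, 0 <= F g)%E ->
  (forall g1 g2, is_fpath g1 -> is_fpath g2 -> trace g1 = trace g2 ->
    (fpath_prob g2)%:E * F g1 = (fpath_prob g1)%:E * F g2)%E ->
  ((fpath_prob h2)%:E *
    (\esum_(g in [set g | is_fpath g /\ image_path g = h1]) F g) =
   (fpath_prob h1)%:E *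
    (\esum_(g in [set g | is_fpath g /\ image_path g = h2]) F g))%E.
Proof.
move=> f1 f2 eh F0 Fobs.
pose lift h g := xget [::]
  [set g2 : fpath M | [/\ is_fpath g2, image_path g2 = h & trace g2 = trace g]].
have liftP h g : is_fpath g -> is_fpath h -> trace (image_path g) = trace h ->
    [/\ is_fpath (lift h g), image_path (lift h g) = h
      & trace (lift h g) = trace g].
  move=> fg fh egh; have [g2 g2P] := image_path_lift fg fh egh.
  apply: (@xgetPex _ [::] [set g2 : fpath M |
    [/\ is_fpath g2, image_path g2 = h & trace g2 = trace g]]).
  by exists g2.
rewrite -!esumZl//; last 2 first.
- exact/ltW/fpath_prob_gt0.
- exact/ltW/fpath_prob_gt0.
rewrite [RHS](reindex_esum [set g | is_fpath g /\ image_path g = h1] _ (lift h2)).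
  apply: eq_esum => g /= [fg hg].
  have [|fl hl el] := liftP h2 g fg f2; first by rewrite hg.
  (* [fpath_prob] of an image path is that of any genuine path above it, so the factors are read off
     [g] and its lift. *)
  rewrite -{1}hl -hg fpath_prob_image// fpath_prob_image//.
  exact: Fobs.
split.
- move=> g /= [fg hg].
  by have [|fl hl el] := liftP h2 g fg f2; first by rewrite hg.
- move=> g g' /set_mem/= [fg hg] /set_mem/= [fg' hg'] e.
  have [|fl hl el] := liftP h2 g fg f2; first by rewrite hg.
  have [|fl' hl' el'] := liftP h2 g' fg' f2; first by rewrite hg'.
  by apply: image_path_inj; [rewrite -el e el'|rewrite hg hg'].
- move=> g /= [fg hg].
  have [|fl hl el] := liftP h1 g fg f1; first by rewrite hg eh.
  have [|fl' hl' el'] := liftP h2 (lift h1 g) fl f2; first by rewrite hl.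
  by exists (lift h1 g) => //; apply: image_path_inj; rewrite ?el' ?hl' ?hg.
Qed.

(** Passing from [h2] to [h1] multiplies numerator and denominator by the same ratio
    [fpath_prob h1 / fpath_prob h2], which cancels. *)
Lemma image_obs : observation_based image_strategy.
Proof.
move=> h1 h2 f1 f2 eh; apply/funext => a'.
have Qe : ((fpath_prob h2)%:E * image_prob h1 =
    (fpath_prob h1)%:E * image_prob h2)%E.
  apply: esum_fibre_obs => // g1 g2 fg1 fg2 e.
  by rewrite -!EFinM mulrC [in RHS]mulrC path_prob_obs.
have Ne : ((fpath_prob h2)%:E * image_act_prob h1 a' =
    (fpath_prob h1)%:E * image_act_prob h2 a')%E.
  apply: esum_fibre_obs => //.
    by move=> g; apply: esum_ge0 => a _; rewrite lee_fin.
  move=> g1 g2 fg1 fg2 e; rewrite -!esumZl.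
  - rewrite (alpha_trace e); apply: eq_esum => a _.
    rewrite -!EFinM (sigma_obs fg1 fg2 e) !mulrA; congr (_ * _)%:E.
    by rewrite mulrC [RHS]mulrC path_prob_obs.
  - exact/ltW/fpath_prob_gt0.
  - by move=> a; rewrite lee_fin.
  - exact/ltW/fpath_prob_gt0.
  - by move=> a; rewrite lee_fin.
have t1 := fpath_prob_gt0 f1; have t2 := fpath_prob_gt0 f2.
move: Qe Ne; rewrite /image_strategy.
rewrite -[image_prob h1]fineK ?image_prob_fin//.
rewrite -[image_prob h2]fineK ?image_prob_fin//.
rewrite -[image_act_prob h1 a']fineK ?image_act_prob_fin//.
rewrite -[image_act_prob h2 a']fineK ?image_act_prob_fin// -!EFinM.
move: (fine _) (fine _) (fine _) (fine _) => n2 n1 q2 q1 [Qe] [Ne].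
rewrite !eqe /=.
(* The default [a0] is played after both image paths or after neither. *)
have -> : (q1 == 0) = (q2 == 0).
  apply/eqP/eqP => q0; move: Qe; rewrite q0 mulr0.
    by move/esym/eqP; rewrite mulf_eq0 gt_eqF//= => /eqP.
  by move/eqP; rewrite mulf_eq0 gt_eqF//= => /eqP.
case: eqP => // /eqP q20.
have {}Qe : q1 = fpath_prob h1 / fpath_prob h2 * q2.
  by rewrite mulrAC -Qe mulrAC mulfV ?mul1r// gt_eqF.
have {}Ne : n1 = fpath_prob h1 / fpath_prob h2 * n2.
  by rewrite mulrAC -Ne mulrAC mulfV ?mul1r// gt_eqF.
rewrite Qe Ne -mulf_div divff ?mul1r// mulf_neq0 ?invr_eq0 ?gt_eqF//.
Qed.

Theorem transfer : exists (sigma' : fpath M' -> pomdp_act M' -> R)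
    (mu' : probability (run_space M') R),
  [/\ is_strategy sigma', observation_based sigma', induced_measure sigma' mu',
    (forall A, mu' A = mu (image_run @^-1` A)) &
    forall f : run_space M' -> \bar R, measurable_fun setT f ->
      (forall w, 0 <= f w)%E ->
      (\int[mu']_w f w = \int[mu]_w f (image_run w))%E].
Proof.
have [mu' [mu'E mu'I]] := pushforward_probability mu measurable_image_run.
exists image_strategy, mu'; split => //.
- exact: image_is_strategy.
- exact: image_obs.
move=> n B; rewrite mu'E.
under [RHS]eq_esum do rewrite path_prob_image.
have -> : image_run @^-1` [set w | B (run_prefix w n)] =
    [set w | (image_path @^-1` B) (run_prefix w n)].
  by apply/seteqP; split=> w; rewrite /preimage/= run_prefix_image_run.
(* Source paths of length [n] are grouped by image; those that are not genuine weigh nothing, so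
   each group sums to [image_prob]. *)
rewrite mu_sigma (esum_fibres
  (J := [set h : fpath M' | size h = n /\ B h]) (g := image_path)).
- apply: eq_esum => h [sh Bh].
  rewrite /image_prob esum_mkcond [RHS]esum_mkcond; apply: eq_esum => g _.
  case: ifPn => [/set_mem/= [[sg Bg] hg]|].
    case: ifPn => //; rewrite notin_setE/= => /not_andP[nf|//].
    by rewrite P_eq0.
  rewrite notin_setE/= => ng; case: ifPn => // /set_mem/= [fg hg].
  by case: ng; rewrite hg -(size_image_path g) hg.
- by move=> g; rewrite lee_fin.
- by move=> g [/= <- Bg]; rewrite size_image_path.
Qed.

End transfer.

(** * Retimed runs *)

Section time_domains.
Variables (R : realType) (P : popta R).
Implicit Types (T : time_domain R (clock P)) (l : loc P) (a : act P).

(* A reset is visible in the valuations only if the clock was nonzero. *)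
Definition reset_clocks T (v w : {ffun clock P -> time T}) : {set clock P} :=
  [set x | (v x != time0 T) && (w x == time0 T)]%SET.

Definition nonzero_resets T (l : loc P) (v : {ffun clock P -> time T}) a :=
  forall (Y : {set clock P}) l' x, 0 < prob l a (Y, l') -> x \in Y ->
    v x != time0 T.

Definition elapsed T (g : fpath (sem T)) : R :=
  \sum_(e <- g) (if e.1 is inr d then dur d else 0).

Lemma elapsed_rcons T (g : fpath (sem T)) (e : sem_act T * sem_state T) :
  elapsed (rcons g e : fpath (sem T)) =
  elapsed g + (if e.1 is inr d then dur d else 0).
Proof. by rewrite /elapsed -cats1 big_cat big_seq1. Qed.

(** Delays are actions and hence recorded in the trace; so a retimed delay may depend on the
    absolute time and still be observation-based. *)
Lemma elapsed_trace T (g h : fpath (sem T)) :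
  trace g = trace h -> elapsed g = elapsed h.
Proof.
move=> e; pose F (e : sem_act T * pomdp_obsT (sem T)) :=
  if e.1 is inr d then dur d else 0.
have H (g' : fpath (sem T)) : elapsed g' = \sum_(e <- trace g') F e.
  by rewrite /trace big_map.
by rewrite !H e.
Qed.

Lemma reset_clocksK T l (v : {ffun clock P -> time T}) a Y l' :
  nonzero_resets l v a -> 0 < prob l a (Y, l') ->
  reset_clocks v (reset v Y) = Y.
Proof.
move=> nz pY; apply/setP => x; rewrite !inE ffunE.
case: ifP => [xY|xY]; first by rewrite eqxx (nz _ _ _ pY).
by case: eqVneq.
Qed.

(** Splits the transition distribution into point masses, one per outcome of [prob]. *)
Lemma sem_trans_act T (s s' : sem_state T) a : sem_trans s (inl a) s' =
  \sum_(u : {set clock P} * loc P)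
    if s' == (u.2, reset s.2 u.1) then prob s.1 a u else 0.
Proof.
transitivity (\sum_(Y : {set clock P}) \sum_(l : loc P)
    if s' == (l, reset s.2 Y) then prob s.1 a (Y, l) else 0); last first.
  by rewrite pair_bigA /=; apply: eq_bigr => -[].
rewrite /= big_mkcond; apply: eq_bigr => Y _.
rewrite (bigD1 s'.1)//= big1 ?addr0; last first.
  by move=> l /negbTE ne; case: ifP => // /eqP e; rewrite e eqxx in ne.
by case: s' => l v /=; rewrite xpair_eqE eqxx.
Qed.

Lemma sem_trans_gt0 T (s s' : sem_state T) a : 0 < sem_trans s (inl a) s' ->
  exists2 Y, 0 < prob s.1 a (Y, s'.1) & s'.2 = reset s.2 Y.
Proof.
move=> pos; apply: contrapT => H; move: pos.
rewrite /= big1 ?ltxx// => Y /eqP e; apply/eqP; rewrite eq_le prob_ge0 andbT.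
by rewrite leNgt; apply/negP => p; apply: H; exists Y.
Qed.

(** Distinct reset sets of positive probability yield distinct valuations, so a single term of the
    sum survives. *)
Lemma sem_trans_reset T l (v : {ffun clock P -> time T}) a Y l' :
  nonzero_resets l v a -> 0 < prob l a (Y, l') ->
  sem_trans (l, v) (inl a) (l', reset v Y) = prob l a (Y, l').
Proof.
move=> nz pY /=; rewrite (bigD1 Y)//= big1 ?addr0// => Z /andP[/eqP e ZY].
apply/eqP; rewrite eq_le prob_ge0 andbT leNgt; apply/negP => pZ.
by move: ZY; rewrite -(reset_clocksK nz pZ) -e (reset_clocksK nz pY) eqxx.
Qed.

Lemma sem_trans_delay T (s s' : sem_state T) d : 0 < sem_trans s (inr d) s' ->
  s' = (s.1, delay s.2 d).
Proof. by rewrite /=; case: eqP => // _; rewrite ltxx. Qed.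

End time_domains.

Section retime.
Variables (R : realType) (P : popta R) (T T' : time_domain R (clock P)).
(** The first argument is the absolute time at which the delay starts. *)
Variable dl : R -> time T -> time T'.

Definition retime_act (g : fpath (sem T)) (b : sem_act T) : sem_act T' :=
  match b with inl a => inl a | inr d => inr (dl (elapsed g) d) end.

(** Location and reset set are copied from the source step; clock values evolve from those of the
    image path. *)
Definition retime_state (g : fpath (sem T)) (h : fpath (sem T'))
    (e : sem_act T * sem_state T) : sem_state T' :=
  (e.2.1, match e.1 with
          | inl _ => reset (last_state h).2
                       (reset_clocks (last_state g).2 e.2.2)
          | inr d => delay (last_state h).2 (dl (elapsed g) d)
          end).

Definition retime_path : fpath (sem T) -> fpath (sem T') :=
  @image_path R (sem T) (sem T') retime_act retime_state.

Definition retime_run : run (sem T) -> run (sem T') :=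
  @image_run R (sem T) (sem T') retime_act retime_state.

Lemma retime_path_rcons g (e : sem_act T * sem_state T) :
  retime_path (rcons g e : fpath (sem T)) =
  rcons (retime_path g) (retime_act g e.1, retime_state g (retime_path g) e).
Proof. exact: image_path_rcons. Qed.

Lemma retime_path_loc g : (last_state (retime_path g)).1 = (last_state g).1.
Proof.
by elim/last_ind: g => // g e _; rewrite retime_path_rcons !last_state_rcons.
Qed.

Lemma retime_run_loc w n :
  (state_at (retime_run w) n).1 = (state_at w n).1.
Proof.
rewrite /state_at /retime_run run_prefix_image_run -/retime_path.
by rewrite retime_path_loc.
Qed.

Lemma hits_retime O w n :
  hits (obs_target O) (retime_run w) n = hits (obs_target O) w n.
Proof. by rewrite /hits /obs_target /= /sem_obs retime_run_loc. Qed.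

(** A simulation invariant at a given absolute time. Visibility of resets is assumed in the target
    only; [I_zero] pulls it back to the source. *)
Variable I : R -> {ffun clock P -> time T} -> {ffun clock P -> time T'} -> Prop.
Hypothesis I_init : I 0 [ffun=> time0 T] [ffun=> time0 T'].
Hypothesis I_delay : forall t v v' d, I t v v' ->
  I (t + dur d) (delay v d) (delay v' (dl t d)).
Hypothesis I_reset : forall t v v' Y, I t v v' -> I t (reset v Y) (reset v' Y).
Hypothesis I_enab : forall t v v' l a, I t v v' ->
  vsat v (enab l a) -> vsat v' (enab l a).
Hypothesis I_inv : forall t v v' l d, I t v v' ->
  sem_avail (l, v) (inr d) -> sem_avail (l, v') (inr (dl t d)).
Hypothesis I_zero : forall t v v' x, I t v v' -> v x = time0 T ->
  v' x = time0 T'.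
Hypothesis nonzero' : forall (h : fpath (sem T')) a, is_fpath h ->
  vsat (last_state h).2 (enab (last_state h).1 a) ->
  nonzero_resets (last_state h).1 (last_state h).2 a.

Let I_nonzero (g : fpath (sem T)) a : is_fpath (retime_path g) ->
  I (elapsed g) (last_state g).2 (last_state (retime_path g)).2 ->
  vsat (last_state g).2 (enab (last_state g).1 a) ->
  nonzero_resets (last_state g).1 (last_state g).2 a.
Proof.
move=> fh Ig /(I_enab Ig); rewrite -retime_path_loc => en Y l' x pY xY.
have := nonzero' fh en pY xY.
by apply: contra_neq => /(I_zero Ig).
Qed.

(** The two claims need each other: replaying a reset requires it to be visible, and [I_nonzero]
    gets this from the legality and the invariant of the prefix. *)
Lemma retime_path_fpath g : is_fpath g -> is_fpath (retime_path g) /\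
  I (elapsed g) (last_state g).2 (last_state (retime_path g)).2.
Proof.
elim/last_ind: g => [_|g [b s] IH].
  by rewrite /elapsed big_nil.
move=> /is_fpath_rcons[/= fg av tr]; have [fh Ig] := IH fg.
rewrite retime_path_rcons elapsed_rcons !last_state_rcons/=.
case: b av tr => [a|d] av tr.
  rewrite addr0; have nz := I_nonzero fh Ig av.
  have [Y pY sY] := sem_trans_gt0 tr.
  have en : vsat (last_state (retime_path g)).2
      (enab (last_state (retime_path g)).1 a).
    by rewrite retime_path_loc; exact: (I_enab Ig).
  have pY' : 0 < prob (last_state (retime_path g)).1 a (Y, s.1).
    by rewrite retime_path_loc.
  rewrite /retime_state /= sY (reset_clocksK nz pY); split; last exact: I_reset.
  apply/is_fpath_rcons; split => //=.
  have := sem_trans_reset (nonzero' fh en) pY'.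
  by rewrite /= => ->.
rewrite (sem_trans_delay tr) /=; split; last exact: I_delay.
apply/is_fpath_rcons; split => //.
  have := I_inv (l := (last_state g).1) Ig.
  rewrite -!surjective_pairing => /(_ _ av).
  by rewrite -[in X in X -> _]retime_path_loc -surjective_pairing.
by rewrite /= retime_path_loc eqxx.
Qed.

Lemma retime_nonzero (g : fpath (sem T)) a : is_fpath g ->
  vsat (last_state g).2 (enab (last_state g).1 a) ->
  nonzero_resets (last_state g).1 (last_state g).2 a.
Proof. by move=> /retime_path_fpath[fh Ig]; exact: I_nonzero. Qed.

Lemma retime_avail (g : fpath (sem T)) b :
  is_fpath g -> sem_avail (last_state g) b ->
  sem_avail (last_state (retime_path g)) (retime_act g b).
Proof.
move=> /retime_path_fpath[fh Ig]; case: b => [a|d] av.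
  by rewrite /= retime_path_loc; exact: (I_enab Ig).
have := I_inv (l := (last_state g).1) Ig.
rewrite -!surjective_pairing => /(_ _ av).
by rewrite -[in X in X -> _]retime_path_loc -surjective_pairing.
Qed.

Lemma retime_trans_step (g : fpath (sem T)) b s :
  is_fpath g -> sem_avail (last_state g) b ->
  0 < sem_trans (last_state g) b s ->
  sem_trans (last_state (retime_path g)) (retime_act g b)
    (retime_state g (retime_path g) (b, s)) = sem_trans (last_state g) b s.
Proof.
move=> fg av tr; have [fh Ig] := retime_path_fpath fg.
have := retime_avail fg av; case: b av tr => [a|d] av tr av'.
  have nz := retime_nonzero fg av.
  have [Y pY sY] := sem_trans_gt0 tr.
  have pY' : 0 < prob (last_state (retime_path g)).1 a (Y, s.1).
    by rewrite retime_path_loc.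
  have := sem_trans_reset nz pY.
  have := sem_trans_reset (nonzero' fh av') pY'.
  rewrite -!surjective_pairing -sY -surjective_pairing => e' ->.
  by rewrite /retime_state /= sY (reset_clocksK nz pY) -retime_path_loc -e'.
rewrite (sem_trans_delay tr) /retime_state /= retime_path_loc.
by rewrite !eqxx.
Qed.

(** For an action, both sides are sums of point masses over the outcomes of [prob], and
    [retime_state] sends the state of each outcome of positive probability to the target state of
    the same outcome. *)
Lemma retime_trans_lump (g : fpath (sem T)) b s' :
  is_fpath g -> sem_avail (last_state g) b ->
  (\esum_(s in [set s | retime_state g (retime_path g) (b, s) = s'])
     (sem_trans (last_state g) b s)%:E)%E =
  (sem_trans (last_state (retime_path g)) (retime_act g b) s')%:E.
Proof.
move=> fg av; rewrite esum_mkcond.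
pose B s := retime_state g (retime_path g) (b, s).
transitivity (\esum_(s in [set: sem_state T])
    (if B s == s' then sem_trans (last_state g) b s else 0)%:E)%E.
  apply: eq_esum => s _; case: eqP => e.
    by rewrite ifT// inE.
  by rewrite ifF//; apply/negbTE; rewrite notin_setE.
have point (s0 : sem_state T) (c : R) : 0 <= c ->
    (\esum_(s in [set: sem_state T])
      (if B s == s' then if s == s0 then c else 0 else 0)%:E)%E =
    (if B s0 == s' then c else 0)%:E.
  move=> c0; rewrite -(esum_point s0); last by case: ifP.
  apply: eq_esum => s _; case: (eqVneq s s0) => [->//|_].
  by case: ifP.
case: b av @B point => [a|d] av B point; last first.
  rewrite point//= /B /retime_state /= retime_path_loc eq_sym.
  by case: s' {B point} => l' v'.
have nz := retime_nonzero fg av.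
under eq_esum => s _.
  rewrite sem_trans_act (_ : (if B s == s' then _ else _) =
    \sum_(u : {set clock P} * loc P) if B s == s' then
      if s == (u.2, reset (last_state g).2 u.1)
      then prob (last_state g).1 a u else 0 else 0); last first.
    by case: ifP => // _; rewrite big1.
  rewrite -sumEFin.
  over.
rewrite esum_sum; last first.
  by move=> s u _ _; rewrite lee_fin; do 2 case: ifP => // _; exact: prob_ge0.
rewrite [retime_act _ _]/= sem_trans_act -sumEFin.
apply: eq_bigr => -[Y l'] _.
rewrite point ?prob_ge0//= /B /retime_state /= retime_path_loc eq_sym.
have := prob_ge0 (last_state g).1 a (Y, l').
rewrite le_eqVlt => /orP[/eqP <-|pY]; first by rewrite !if_same.
by rewrite (reset_clocksK nz pY).
Qed.

Lemma retime_trans_lift (g1 g2 : fpath (sem T)) b s (s' : sem_state T') :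
  is_fpath g1 -> is_fpath g2 ->
  trace g1 = trace g2 -> trace (retime_path g1) = trace (retime_path g2) ->
  sem_avail (last_state g1) b -> 0 < sem_trans (last_state g1) b s ->
  0 < sem_trans (last_state (retime_path g2)) (retime_act g2 b) s' ->
  sem_obs (retime_state g1 (retime_path g1) (b, s)) = sem_obs s' ->
  exists s2 : sem_state T, [/\ sem_obs s2 = sem_obs s,
    0 < sem_trans (last_state g2) b s2 &
    retime_state g2 (retime_path g2) (b, s2) = s'].
Proof.
move=> f1 f2 et et' av tr1 tr2 [os vs].
have [fh1 Ig1] := retime_path_fpath f1; have [fh2 Ig2] := retime_path_fpath f2.
have /= := trace_last et; rewrite /sem_obs => -[ol ov].
have /= := trace_last et'; rewrite /sem_obs => -[ol' ov'].
have av2 : sem_avail (last_state g2) b.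
  by have /= <- := pomdp_obs_avail (trace_last et).
have av1' := retime_avail f1 av; have av2' := retime_avail f2 av2.
(* The location is that of the target step, the valuation that of the source step. For an action,
   both steps use the same reset set, as it is visible in the common image valuation. *)
exists (s'.1, s.2); split.
- by rewrite /sem_obs/= -os.
- case: b av tr1 tr2 os vs av2 av1' av2' => [a|d] av tr1 tr2 os vs av2 av1' av2'.
    have [Y1 pY1 sY1] := sem_trans_gt0 tr1.
    have [Y pY sY] := sem_trans_gt0 tr2.
    have nz := retime_nonzero f1 av.
    have eY : reset (last_state (retime_path g1)).2 Y1 =
        reset (last_state (retime_path g2)).2 Y.
      by rewrite -sY -vs /= sY1 (reset_clocksK nz pY1).
    have pY1' : 0 < prob (last_state (retime_path g1)).1 a (Y1, s.1).
      by rewrite retime_path_loc.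
    have Y1K := reset_clocksK (nonzero' fh1 av1') pY1'.
    have YK := reset_clocksK (nonzero' fh2 av2') pY.
    have YY1 : Y1 = Y by rewrite -Y1K eY -[RHS]YK ov'.
    have pY2 : 0 < prob (last_state g2).1 a (Y, s'.1).
      by rewrite -retime_path_loc.
    have := sem_trans_reset (retime_nonzero f2 av2) pY2.
    by rewrite -surjective_pairing sY1 YY1 ov => ->.
  have -> : s = ((last_state g1).1, delay (last_state g1).2 d).
    exact: sem_trans_delay.
  have -> : s' = ((last_state (retime_path g2)).1,
      delay (last_state (retime_path g2)).2 (dl (elapsed g2) d)).
    exact: sem_trans_delay.
  by rewrite /= retime_path_loc ov eqxx.
- move: vs; rewrite /retime_state/=.
  rewrite -ov -ov' (elapsed_trace et).
  by case: b {av tr1 tr2 os av2 av1' av2'} => [a|d] /= ->;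
    rewrite -surjective_pairing.
Qed.

Hypothesis delay0_avail : forall h : fpath (sem T'), is_fpath h ->
  sem_avail (last_state h) (inr (time0 T')).

Lemma retime_transfer (sigma : fpath (sem T) -> sem_act T -> R)
    (mu : probability (run_space (sem T)) R) :
  is_strategy sigma -> observation_based sigma -> induced_measure sigma mu ->
  exists (sigma' : fpath (sem T') -> sem_act T' -> R)
    (mu' : probability (run_space (sem T')) R),
  [/\ is_strategy sigma', observation_based sigma', induced_measure sigma' mu',
    (forall A, mu' A = mu (retime_run @^-1` A)) &
    forall f : run_space (sem T') -> \bar R, measurable_fun setT f ->
      (forall w, 0 <= f w)%E ->
      (\int[mu']_w f w = \int[mu]_w f (retime_run w))%E].
Proof.
move=> st ob im.
apply: (@transfer R (sem T) (sem T') retime_act retime_state _ _ _ _ _ _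
  (inr (time0 T')) _ sigma st ob mu im).
- move=> g1 g2 e; apply/funext => -[//|d] /=.
  by rewrite /retime_act (elapsed_trace e).
- exact: retime_avail.
- exact: retime_trans_lump.
- exact: retime_trans_step.
- exact: retime_trans_lift.
- by move=> g h b [l1 v1] [l2 v2] [-> _] [->].
- exact: delay0_avail.
Qed.

Lemma reach_event_retime (O : {set locobs P}) :
  retime_run @^-1` (reach_event (obs_target O)) = reach_event (obs_target O).
Proof.
by apply/seteqP; split=> w [n hn]; exists n; move: hn; rewrite hits_retime.
Qed.

End retime.

(** * Accumulated rewards and rounding *)

Section constraints.
Variables (R : realType) (X : finType).
Implicit Types (f g h : X -> R) (chi : cconstr X).

Lemma sat_bounds f g chi : closed_cc chi -> diagonal_free_cc chi ->
  (forall x (d : nat), (d <= cc_max x chi)%N ->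
    (f x <= d%:R -> g x <= d%:R) /\ (d%:R <= f x -> d%:R <= g x)) ->
  sat f chi -> sat g chi.
Proof.
elim: chi => //= [x c d|chi1 IH1 chi2 IH2].
  by move=> cc _ /(_ x d); rewrite eqxx leqnn => -[]//; case: c cc.
move=> /andP[c1 c2] /andP[d1 d2] H /andP[s1 s2]; apply/andP; split.
  by apply: IH1 => // x d le; apply: H; rewrite leq_max le.
by apply: IH2 => // x d le; apply: H; rewrite leq_max le orbT.
Qed.

(** Such constraints define boxes; hence an invariant true at both ends of a delay is true
    throughout. *)
Lemma sat_between f g h chi : closed_cc chi -> diagonal_free_cc chi ->
  (forall x, f x <= g x <= h x) -> sat f chi -> sat h chi -> sat g chi.
Proof.
move=> + + fgh; elim: chi => //= [x c d|chi1 IH1 chi2 IH2].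
  have /andP[fg gh] := fgh x.
  case: c => //= _ _; first by move=> _; exact: le_trans gh.
  by move=> df _; exact: le_trans df fg.
by move=> /andP[? ?] /andP[? ?] /andP[? ?] /andP[? ?]; rewrite IH1// IH2.
Qed.

End constraints.

Section reward.
Variables (R : realType) (M : pomdp R) (O : set (pomdp_obsT M)).
Implicit Types (w : run M).

(** Every set of prefixes is an event, so dependence on a prefix alone suffices. *)
Lemma measurable_fun_prefix d (T : measurableType d) (F : run M -> T) n :
  (forall w w', (forall i, (i < n)%N -> w i = w' i) -> F w = F w') ->
  measurable_fun [set: run_space M] F.
Proof.
move=> HF _ Y _; rewrite setTI.
rewrite (_ : _ @^-1` _ = [set w | [set g | exists w' : run M,
    run_prefix w' n = g /\ Y (F w')] (run_prefix w n)]).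
  exact: measurable_prefix_set.
apply/seteqP; split=> w /= => [Yw|]; first by exists w.
move=> [w' [e Yw']]; rewrite /preimage/= (HF w w')// => i lt.
move/(congr1 (fun s => nth (w i) s i)): e.
by rewrite !nth_mkseq// => ->.
Qed.

Lemma run_prefix_eq w w' n : (forall i, (i < n)%N -> w i = w' i) ->
  run_prefix w n = run_prefix w' n.
Proof.
move=> H; apply/eq_in_map => i; rewrite mem_iota => /andP[_]; exact: H.
Qed.

(** Index [i] is included, since the reward of stage [i] is earned on leaving the state at [i]. *)
Definition unhit w i := [forall j : 'I_i.+1, ~~ hits O w j].

Definition stage_reward w i : R :=
  if unhit w i then pomdp_reward (state_at w i) (w i).1 else 0.

Definition miss_penalty w : \bar R :=
  if `[< reach_event O w >] then 0%E else +oo%E.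

Lemma stage_reward_ge0 w i : 0 <= stage_reward w i.
Proof. by rewrite /stage_reward; case: ifP => // _; exact: pomdp_reward_ge0. Qed.

Lemma miss_penalty_ge0 w : (0 <= miss_penalty w)%E.
Proof. by rewrite /miss_penalty; case: ifP. Qed.

Lemma unhit_eq w w' i : (forall j, (j < i)%N -> w j = w' j) ->
  unhit w i = unhit w' i.
Proof.
move=> H; apply: eq_forallb => j; rewrite /hits /state_at.
rewrite (@run_prefix_eq w w')// => k lt; apply: H.
by rewrite (leq_trans lt)// -ltnS.
Qed.

(** As a series with a separate penalty for missing [O], the reward can be measured and integrated
    stage by stage. *)
Lemma reach_rewardE w :
  reach_reward O w = (\sum_(i <oo) (stage_reward w i)%:E + miss_penalty w)%E.
Proof.
have S0 k : (0 <= k)%N -> (0 <= (stage_reward w k)%:E)%E.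
  by rewrite lee_fin stage_reward_ge0.
rewrite /reach_reward /miss_penalty; case: pselect => [ex|nex]; last first.
  rewrite asboolF// addey//.
  rewrite -ltNye; apply: lt_le_trans (ltNyr 0) _.
  by apply: nneseries_ge0 => k _ _; exact: S0.
rewrite asboolT// adde0; case: ex_minnP => n hn mn.
rewrite (nneseries_split 0 n)// add0n eseries0 ?adde0; last first.
  move=> i ni _; rewrite /stage_reward ifF//; apply/negbTE/forallPn.
  have ni' : (n < i.+1)%N by [].
  by exists (Ordinal ni'); rewrite negbK.
rewrite big_mkord sumEFin; congr EFin; apply: eq_bigr => i _.
rewrite /stage_reward ifT//; apply/forallP => j; apply/negP => /mn.
by rewrite leqNgt (leq_trans (ltn_ord j)).
Qed.

Lemma reach_reward_ge0 w : (0 <= reach_reward O w)%E.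
Proof.
rewrite reach_rewardE adde_ge0 ?miss_penalty_ge0//.
by apply: nneseries_ge0 => i _ _; rewrite lee_fin stage_reward_ge0.
Qed.

Lemma measurable_stage_reward i :
  measurable_fun [set: run_space M] (fun w => stage_reward w i).
Proof.
apply: (@measurable_fun_prefix _ _ _ i.+1) => w w' H.
rewrite /stage_reward (@unhit_eq w w'); last by move=> j /ltnW; exact: H.
rewrite /state_at (@run_prefix_eq w w') ?H//.
by move=> j /ltnW; exact: H.
Qed.

Lemma measurable_miss_penalty : measurable_fun [set: run_space M] miss_penalty.
Proof.
apply: measurable_fun_ifT => //.
apply: (measurable_fun_bool true); rewrite setTI.
rewrite (_ : _ @^-1` _ = \bigcup_n [set w : run_space M |
    [set g : fpath M | O (pomdp_obs (last_state g))] (run_prefix w n)]).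
  by apply: bigcup_measurable => n _; exact: measurable_prefix_set.
apply/seteqP; split=> w /=.
  by move=> /asboolP[n /asboolP hn]; exists n.
by move=> [n _ hn]; apply/asboolP; exists n; apply/asboolP.
Qed.

Lemma measurable_reach_reward :
  measurable_fun [set: run_space M] (fun w : run_space M => reach_reward O w).
Proof.
under eq_fun do rewrite reach_rewardE.
apply: emeasurable_funD; last exact: measurable_miss_penalty.
apply: ge0_emeasurable_sum.
  by move=> k w _ _; rewrite lee_fin stage_reward_ge0.
by move=> k _; apply/measurable_EFinP; exact: measurable_stage_reward.
Qed.

End reward.

Section truncation.
Variable R : realType.
Implicit Types (t r u : R) (d n : nat).

Lemma truncnDn u d : 0 <= u -> Num.truncn (u + d%:R) = (Num.truncn u + d)%N.
Proof.
move=> u0; rewrite addrC truncnD ?natr_nat ?nnegrE//.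
by rewrite natrK addnC.
Qed.

(** Truncation is monotone and commutes with adding [d], so comparisons of a duration with a natural
    number survive the rounding of its endpoints. *)
Lemma truncn_sub_bounds t r u d : 0 <= r <= t -> 0 <= u ->
  (t - r <= d%:R -> (Num.truncn (t + u) - Num.truncn (r + u) <= d)%N) /\
  (d%:R <= t - r -> (d <= Num.truncn (t + u) - Num.truncn (r + u))%N).
Proof.
move=> /andP[r0 rt] u0; have ru0 : 0 <= r + u by exact: addr_ge0.
split=> H.
  rewrite leq_subLR -truncnDn//; apply: le_truncn; lra.
have : (Num.truncn (r + u + d%:R) <= Num.truncn (t + u))%N.
  by apply: le_truncn; lra.
by rewrite truncnDn//; lia.
Qed.

Lemma measurable_truncn :
  measurable_fun [set: R] (fun x : R => (Num.truncn x)%:R : R).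
Proof.
apply: nondecreasing_measurable => // x y xy.
by rewrite ler_nat le_truncn.
Qed.

Lemma integral_truncn t : 0 <= t ->
  (\int[lebesgue_measure]_(u in `[0%R, 1%R[) ((Num.truncn (t + u))%:R)%:E)%E =
  t%:E.
Proof.
move=> t0; set n := Num.truncn t.
have /andP[nt tn] := truncn_itv t0.
(* For [u] in [0, 1[, the integral part of [t + u] is [n], or [n.+1] once [u] reaches
   [n.+1%:R - t]. *)
pose A : set R := [set` `[n.+1%:R - t, +oo[].
transitivity (\int[lebesgue_measure]_(u in `[0%R, 1%R[)
    ((n%:R)%:E + (\1_A u)%:E))%E.
  apply: eq_integral => u; rewrite inE/= in_itv/= => /andP[u0 u1].
  rewrite -EFinD; congr EFin; rewrite indicE.
  have [uA|uA] := boolP (u \in A).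
    move: uA; rewrite inE /A/= in_itv/= andbT => uA.
    rewrite (@truncn_def _ _ n.+1) ?natr1// -!natr1.
    move: tn uA; rewrite -/n -!natr1; lra.
  move: uA; rewrite notin_setE /A/= in_itv/= andbT => /negP; rewrite -ltNge => uA.
  rewrite (@truncn_def _ _ n) ?addr0//.
  move: nt uA; rewrite -/n -!natr1; lra.
rewrite ge0_integralD//; last first.
  by apply/measurable_EFinP/measurable_indic; exact: measurable_itv.
rewrite integral_cst//= lebesgue_measure_itv/= lte_fin ltr01.
rewrite -EFinB subr0 mule1 integral_indic//=; last exact: measurable_itv.
rewrite (_ : A `&` _ = [set` `[n.+1%:R - t, 1%R[]); last first.
  apply/seteqP; split=> u; rewrite /A /= !in_itv/= ?andbT.
    by move=> [h /andP[_ ->]]; rewrite h.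
  move=> /andP[h ->]; split=> //; rewrite andbT; apply: le_trans h.
  by rewrite subr_ge0 ltW.
rewrite lebesgue_measure_itv/= lte_fin; case: ifPn => h.
  by rewrite -EFinB -EFinD; congr EFin; rewrite -natr1; lra.
(* The jump falls outside [0, 1[ only when [t] equals [n]. *)
rewrite adde0; congr EFin; move: h nt; rewrite -leNgt -/n -natr1; lra.
Qed.

End truncation.

Section retime_reward.
Variables (R : realType) (P : popta R) (T T' : time_domain R (clock P)).
Variables (dl : R -> time T -> time T') (O : {set locobs P}).

Lemma stage_reward_retime (w : run (sem T)) i :
  stage_reward (obs_target O) (retime_run dl w) i =
  if unhit (obs_target O) w i then
    match (w i).1 with
    | inl a => rew_act (state_at w i).1 a
    | inr d => rew_loc (state_at w i).1 *
                 dur (dl (elapsed (run_prefix w i)) d)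
    end
  else 0.
Proof.
rewrite /stage_reward (_ : unhit _ _ i = unhit (obs_target O) w i); last first.
  by apply: eq_forallb => j; rewrite hits_retime.
case: ifP => // _; rewrite /= -(retime_run_loc dl) /retime_run /image_run/=.
by case: (w i).1.
Qed.

Lemma miss_penalty_retime (w : run (sem T)) :
  miss_penalty (obs_target O) (retime_run dl w) = miss_penalty (obs_target O) w.
Proof. by rewrite /miss_penalty -[in RHS](reach_event_retime dl). Qed.

End retime_reward.

(** * Comparison of digital and dense clocks *)

Section digital_clocks.
Variables (R : realType) (P : popta R).
Hypotheses (wfP : well_formed P) (closedP : closed_popta P)
  (diagP : diagonal_free P) (resP : resets_nonzero P).

Local Notation Treal := (real_time R (clock P)).
Local Notation Tdig := (digital_time P).
Local Notation rval := {ffun clock P -> {nonneg R}}.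
Local Notation dval := {ffun clock P -> nat}.

Lemma cc_max_inv x l : (cc_max x (inv l) <= @max_const R P x)%N.
Proof.
rewrite /max_const leq_max; apply/orP; left.
exact: (@leq_bigmax _ (fun l : loc P => cc_max x (inv l))).
Qed.

Lemma cc_max_enab x l a : (cc_max x (enab l a) <= @max_const R P x)%N.
Proof.
rewrite /max_const leq_max; apply/orP; right.
apply: leq_trans (leq_bigmax (F := fun l : loc P => _) l).
exact: (leq_bigmax (F := fun a : act P => cc_max x (enab l a)) a).
Qed.

(* Agreement on all the comparisons that closed constraints of [P] can make. *)
Definition bounds_le (f g : clock P -> R) := forall x (d : nat),
  (d <= max_const x)%N -> (f x <= d%:R -> g x <= d%:R) /\
                          (d%:R <= f x -> d%:R <= g x).

Lemma sat_inv f g l : bounds_le f g -> sat f (inv l) -> sat g (inv l).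
Proof.
move=> fg; apply: sat_bounds; [exact: closedP.1|exact: diagP.1|].
by move=> x d le; apply: fg; exact: leq_trans (cc_max_inv x l).
Qed.

Lemma sat_enab f g l a :
  bounds_le f g -> sat f (enab l a) -> sat g (enab l a).
Proof.
move=> fg; apply: sat_bounds; [exact: closedP.2|exact: diagP.2|].
by move=> x d le; apply: fg; exact: leq_trans (cc_max_enab x l a).
Qed.

(** * From digital to dense time *)

Definition real_delay (_ : R) (n : nat) : {nonneg R} := n%:R%:nng.

(** The cap lies one above the largest constant, so capping changes no comparison made by [P]. *)
Definition capped (_ : R) (v : dval) (v' : rval) := forall x,
  exists2 n : nat, (v' x)%:num = n%:R & v x = minn n (max_const x).+1.

Lemma capped_bounds t v v' : capped t v v' ->
  bounds_le (fun x => (v x)%:R) (fun x => (v' x)%:num) /\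
  bounds_le (fun x => (v' x)%:num) (fun x => (v x)%:R).
Proof.
by move=> vv'; split=> x d le; have [n -> ->] := vv' x; rewrite !ler_nat; lia.
Qed.

Lemma capped_delay t (v : dval) (v' : rval) (d : nat) : capped t v v' ->
  capped (t + d%:R) (@delay _ _ Tdig v d) (@delay _ _ Treal v' (real_delay t d)).
Proof.
move=> vv' x; have [n e1 e2] := vv' x; exists (n + d)%N.
  by rewrite ffunE /= e1 natrD.
by rewrite ffunE e2; lia.
Qed.

Lemma capped_inv t (v : dval) (v' : rval) l (d : nat) : capped t v v' ->
  @sem_avail R P Tdig (l, v) (inr d) ->
  @sem_avail R P Treal (l, v') (inr (real_delay t d)).
Proof.
move=> vv' av t0 /= t0d.
have at_ (m : nat) : (m <= d)%N ->
    sat (fun x => (v' x)%:num + m%:R) (inv l).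
  move=> md; have /sat_inv : bounds_le
      (fun x => (@delay _ _ Tdig v m x)%:R) (fun x => (v' x)%:num + m%:R).
    have [] := capped_bounds (capped_delay m vv') => + _.
    by move=> H x e le; have := H x e le; rewrite !ffunE.
  by apply; apply: av; rewrite /= ler_nat.
(* The digital run vouches for integral delays only; convexity fills in the others. *)
rewrite /vsat/=; apply: (sat_between _ _ _ (at_ 0%N _) (at_ d _)) => //.
- exact: closedP.1.
- exact: diagP.1.
- by move=> x; rewrite ffunE /= addr0 lerDl ge0 lerD2l.
Qed.

Lemma real_nonzero (h : fpath (sem Treal)) a : is_fpath h ->
  vsat (last_state h).2 (enab (last_state h).1 a) ->
  nonzero_resets (last_state h).1 (last_state h).2 a.
Proof.
move=> fh en Y l' x pY xY; have := resP _ en pY xY.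
move=> /(_ (ex_intro2 _ _ h fh _)).
rewrite -surjective_pairing => /(_ erefl).
by apply: contra_neq => ->.
Qed.

Let capped_init : capped 0 [ffun=> time0 Tdig] [ffun=> time0 Treal].
Proof. by move=> x; exists 0%N; rewrite !ffunE. Qed.

Let capped_reset t (v : dval) (v' : rval) Y : capped t v v' ->
  capped t (@reset _ _ Tdig v Y) (@reset _ _ Treal v' Y).
Proof.
move=> vv' x; rewrite !ffunE; case: ifP => _; last exact: vv'.
by exists 0%N.
Qed.

Let capped_enab t (v : dval) (v' : rval) l a : capped t v v' ->
  @vsat _ _ Tdig v (enab l a) -> @vsat _ _ Treal v' (enab l a).
Proof. by move=> /capped_bounds[vv' _]; exact: sat_enab. Qed.

Let capped_zero t (v : dval) (v' : rval) x : capped t v v' ->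
  v x = time0 Tdig -> v' x = time0 Treal.
Proof.
move=> vv' /= v0; have [n e1 e2] := vv' x; apply: val_inj => /=.
by rewrite e1; have -> : n = 0%N by lia.
Qed.

Let real_inv (h : fpath (sem Treal)) : is_fpath h ->
  sat (fun x => ((last_state h).2 x)%:num) (inv (last_state h).1).
Proof. by move=> fh; apply: wfP; exists h; rewrite // -surjective_pairing. Qed.

(** Reachable states satisfy their invariant, so waiting for no time is always possible and can
    serve as the default action. *)
Lemma real_delay0_avail (h : fpath (sem Treal)) : is_fpath h ->
  sem_avail (last_state h) (inr (time0 Treal)).
Proof.
move=> fh t /= t0; apply: sat_inv (real_inv fh) => x d _.
by rewrite ffunE /= (@le_anti _ _ t%:num 0) ?addr0// t0 ge0.
Qed.

Let real_fpath (h : fpath (sem Tdig)) : is_fpath h ->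
  is_fpath (retime_path (T := Tdig) (T' := Treal) real_delay h) /\
  capped (elapsed h) (last_state h).2
    (last_state (retime_path (T := Tdig) (T' := Treal) real_delay h)).2.
Proof.
exact: (retime_path_fpath capped_init capped_delay capped_reset capped_enab
  capped_inv capped_zero real_nonzero).
Qed.

(** [resets_nonzero] speaks of dense runs; it reaches digital paths through their dense retiming. *)
Lemma digital_nonzero (h : fpath (sem Tdig)) a : is_fpath h ->
  vsat (last_state h).2 (enab (last_state h).1 a) ->
  nonzero_resets (last_state h).1 (last_state h).2 a.
Proof.
exact: (retime_nonzero capped_init capped_delay capped_reset capped_enab
  capped_inv capped_zero real_nonzero).
Qed.

Lemma digital_delay0_avail (h : fpath (sem Tdig)) : is_fpath h ->
  sem_avail (last_state h) (inr (time0 Tdig)).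
Proof.
move=> fh t /=; rewrite lern0 => /eqP ->.
have [fh' Ih] := real_fpath fh; have := real_inv fh'.
rewrite retime_path_loc; apply: sat_inv => x d le.
have [_ /(_ x d le)] := capped_bounds Ih.
rewrite ffunE /=; have [n _ ->] := Ih x.
by rewrite addn0 -minnA minnn.
Qed.

Lemma real_transfer (sigma : fpath (sem_N P) -> pomdp_act (sem_N P) -> R)
    (mu : probability (run_space (sem_N P)) R) :
  is_strategy sigma -> observation_based sigma -> induced_measure sigma mu ->
  exists (sigma' : fpath (sem_R P) -> pomdp_act (sem_R P) -> R)
    (mu' : probability (run_space (sem_R P)) R),
  [/\ is_strategy sigma', observation_based sigma', induced_measure sigma' mu',
    (forall A, mu' A = mu (@retime_run R P Tdig Treal real_delay @^-1` A)) &
    forall f : run_space (sem_R P) -> \bar R, measurable_fun setT f ->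
      (forall w, 0 <= f w)%E -> (\int[mu']_w f w =
        \int[mu]_w f (@retime_run R P Tdig Treal real_delay w))%E].
Proof.
exact: (retime_transfer capped_init capped_delay capped_reset capped_enab
  capped_inv capped_zero real_nonzero real_delay0_avail).
Qed.

(** * From dense to digital time *)

(* Absolute times are shifted by [u] and rounded down; averaging over a
   uniform [u] in [0, 1[ gives back the exact times. *)
Definition digital_delay (u t : R) (d : {nonneg R}) : nat :=
  Num.truncn (t + d%:num + u) - Num.truncn (t + u).

(* [r] is the absolute time of the last reset of [x]. *)
Definition digitized (u t : R) (v : rval) (v' : dval) := 0 <= t /\ forall x,
  exists r, [/\ 0 <= r <= t, (v x)%:num = t - r &
    v' x = minn (Num.truncn (t + u) - Num.truncn (r + u)) (max_const x).+1].

Section digitization.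
Variable u : R.
Hypothesis u01 : 0 <= u < 1.

Lemma digitized_bounds t v v' : digitized u t v v' ->
  bounds_le (fun x => (v x)%:num) (fun x => (v' x)%:R).
Proof.
move=> [t0 vv'] x d le; have [r [rt -> ->]] := vv' x.
have [H1 H2] := truncn_sub_bounds d rt (proj1 (andP u01)).
rewrite !ler_nat; move: (max_const x) le H1 H2 => k.
by move: (_ - _)%N => m dk H1 H2; split=> [/H1|/H2]; lia.
Qed.

(** Differences of rounded absolute times telescope, so rounding errors do not accumulate over
    successive delays. *)
Lemma digitized_delay t (v : rval) (v' : dval) (d : {nonneg R}) :
  digitized u t v v' -> digitized u (t + d%:num)
    (@delay _ _ Treal v d) (@delay _ _ Tdig v' (digital_delay u t d)).
Proof.
move=> [t0 vv']; split; first by rewrite addr_ge0.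
move=> x; have [r [/andP[r0 rt] e1 e2]] := vv' x; exists r; split.
- by rewrite r0 (le_trans rt)// lerDl.
- by rewrite ffunE /= e1 addrAC.
rewrite ffunE /= e2 /digital_delay.
have : (Num.truncn (r + u) <= Num.truncn (t + u))%N by rewrite le_truncn// lerD2r.
have : (Num.truncn (t + u) <= Num.truncn (t + d%:num + u))%N.
  by rewrite le_truncn// lerD2r lerDl.
move: (max_const x) => k; move: (Num.truncn (t + u)) (Num.truncn (r + u)) => a b.
move: (Num.truncn _) => c; lia.
Qed.

Let digitized_init : digitized u 0 [ffun=> time0 Treal] [ffun=> time0 Tdig].
Proof.
split=> // x; exists 0; split; rewrite ?lexx// ffunE /= ?subr0//.
by rewrite subnn min0n.
Qed.

Let digitized_reset t (v : rval) (v' : dval) Y : digitized u t v v' ->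
  digitized u t (@reset _ _ Treal v Y) (@reset _ _ Tdig v' Y).
Proof.
move=> [t0 vv']; split=> // x; rewrite !ffunE; case: ifP => _; last exact: vv'.
by exists t; split; rewrite ?t0 ?lexx ?subrr// subnn min0n.
Qed.

Let digitized_enab t (v : rval) (v' : dval) l a : digitized u t v v' ->
  @vsat _ _ Treal v (enab l a) -> @vsat _ _ Tdig v' (enab l a).
Proof. by move=> /digitized_bounds; exact: sat_enab. Qed.

Let digitized_inv t (v : rval) (v' : dval) l (d : {nonneg R}) :
  digitized u t v v' -> @sem_avail R P Treal (l, v) (inr d) ->
  @sem_avail R P Tdig (l, v') (inr (digital_delay u t d)).
Proof.
move=> vv' av m /=; rewrite ler_nat => md.
have at_ (e : {nonneg R}) : e%:num <= d%:num ->
    sat (fun x => (@delay _ _ Tdig v' (digital_delay u t e) x)%:R : R) (inv l).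
  move=> ed.
  exact: (sat_inv (l := l) (digitized_bounds (digitized_delay e vv')) (av e ed)).
(* The dense delays 0 and [d] become the digital delays 0 and [digital_delay u t d], between which
   [m] lies. *)
rewrite /vsat/=; apply: (sat_between _ _ _ (at_ 0%:nng _) (at_ d _)) => //.
- exact: closedP.1.
- exact: diagP.1.
- move=> x; rewrite !ffunE !ler_nat /digital_delay /= addr0 subnn.
  move: md; rewrite /digital_delay; move: (_ - _)%N (max_const x) => D k; lia.
- exact: ge0.
Qed.

Let digitized_zero t (v : rval) (v' : dval) x : digitized u t v v' ->
  v x = time0 Treal -> v' x = time0 Tdig.
Proof.
move=> [t0 vv'] v0; have [r [rt e1 ->]] := vv' x.
have -> : t = r by move: e1; rewrite v0 /=; lra.
by rewrite subnn min0n.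
Qed.

Lemma digitize_transfer (sigma : fpath (sem_R P) -> pomdp_act (sem_R P) -> R)
    (mu : probability (run_space (sem_R P)) R) :
  is_strategy sigma -> observation_based sigma -> induced_measure sigma mu ->
  exists (sigma' : fpath (sem_N P) -> pomdp_act (sem_N P) -> R)
    (mu' : probability (run_space (sem_N P)) R),
  [/\ is_strategy sigma', observation_based sigma', induced_measure sigma' mu',
    (forall A, mu' A =
      mu (@retime_run R P Treal Tdig (digital_delay u) @^-1` A)) &
    forall f : run_space (sem_N P) -> \bar R, measurable_fun setT f ->
      (forall w, 0 <= f w)%E -> (\int[mu']_w f w =
        \int[mu]_w f (@retime_run R P Treal Tdig (digital_delay u) w))%E].
Proof.
exact: (retime_transfer digitized_init digitized_delay digitized_reset
  digitized_enab digitized_inv digitized_zero digital_nonzero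
  digital_delay0_avail).
Qed.

End digitization.
End digital_clocks.

(** * Averaging over the shift *)

Lemma integral_truncn_sub (R : realType) (a c s t : R) :
  0 <= a -> 0 <= c -> 0 <= s <= t ->
  (\int[lebesgue_measure]_(u in `[0%R, 1%R[)
     (a + c * ((Num.truncn (t + u))%:R - (Num.truncn (s + u))%:R))%:E)%E =
  (a + c * (t - s))%:E.
Proof.
move=> a0 c0 /andP[s0 st].
have mtr (r : R) : measurable_fun (`[0%R, 1%R[ : set R)
    (fun u : R => ((Num.truncn (r + u))%:R : R)).
  apply: measurable_funTS; apply: (measurableT_comp (@measurable_truncn R)).
  exact: measurable_funD.
have d0 u : 0 <= (Num.truncn (t + u))%:R - (Num.truncn (s + u))%:R :> R.
  by rewrite subr_ge0 ler_nat le_truncn// lerD2r.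
have dE : (\int[lebesgue_measure]_(u in `[0%R, 1%R[)
    ((Num.truncn (t + u))%:R - (Num.truncn (s + u))%:R)%:E)%E = (t - s)%:E.
  have := integral_truncn (le_trans s0 st).
  (* Writing the later rounded time as the earlier one plus a nonnegative difference needs only
     additivity; the finite mean [s] is then cancelled. *)
  rewrite (_ : (fun u : R => _) = fun u : R => ((Num.truncn (s + u))%:R%:E +
      ((Num.truncn (t + u))%:R - (Num.truncn (s + u))%:R)%:E)%E).
    rewrite ge0_integralD//; last 3 first.
    - by apply/measurable_EFinP; exact: mtr.
    - by move=> u _; rewrite lee_fin.
    - by apply/measurable_EFinP; apply: measurable_funB; exact: mtr.
    rewrite integral_truncn//.
    case: (integral _ _ _) => [r [<-]| |]//.
    by congr EFin; lra.
  by apply/funext => u; rewrite -EFinD addrCA subrr addr0.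
under eq_integral do rewrite EFinD EFinM.
rewrite ge0_integralD//; last 2 first.
- by move=> u _; rewrite -EFinM lee_fin mulr_ge0.
- apply: measurable_funeM; apply/measurable_EFinP.
  by apply: measurable_funB; exact: mtr.
rewrite integral_cst//= lebesgue_measure_itv/= lte_fin ltr01 -EFinB subr0 mule1.
rewrite ge0_integralZl_EFin//; first by rewrite dE.
- by move=> u _; rewrite lee_fin.
- by apply/measurable_EFinP; apply: measurable_funB; exact: mtr.
Qed.

Section averaging.
Variables (R : realType) (P : popta R) (O : {set locobs P}).
Local Notation Treal := (real_time R (clock P)).
Local Notation Tdig := (digital_time P).
Local Notation RO := (@obs_target R P Treal O).
Local Notation NO := (@obs_target R P Tdig O).

Definition digitize_run (u : R) : run (sem_R P) -> run (sem_N P) :=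
  @retime_run R P Treal Tdig (digital_delay u).

(** A stage reward is affine in the time spent in the stage, with coefficients that digitization
    keeps; only the two clock readings are rounded. *)
Let act_part i (w : run (sem Treal)) : R :=
  if unhit RO w i then
    if (w i).1 is inl a then rew_act (state_at w i).1 a else 0
  else 0.

Let rate_part i (w : run (sem Treal)) : R :=
  if unhit RO w i then
    if (w i).1 is inr d then rew_loc (state_at w i).1 else 0
  else 0.

Let clock_at i (w : run (sem Treal)) : R := elapsed (run_prefix w i).

Let act_part_ge0 i w : 0 <= act_part i w.
Proof.
rewrite /act_part; case: ifP => // _; case: (w i).1 => // a; exact: rew_act_ge0.
Qed.

Let rate_part_ge0 i w : 0 <= rate_part i w.
Proof.
rewrite /rate_part; case: ifP => // _; case: (w i).1 => // d.
exact: rew_loc_ge0.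
Qed.

Let clock_at_ge0 i w : 0 <= clock_at i w.
Proof.
by apply: sumr_ge0 => -[[a|d] s] _ //=; exact: ge0.
Qed.

Let clock_atS i w : clock_at i.+1 w = clock_at i w +
  (if (w i).1 is inr d then d%:num else 0).
Proof. by rewrite /clock_at run_prefixS elapsed_rcons. Qed.

Let clock_at_le i w : clock_at i w <= clock_at i.+1 w.
Proof. by rewrite clock_atS lerDl; case: (w i).1. Qed.

Let stage_rewardE i w : stage_reward RO w i =
  act_part i w + rate_part i w * (clock_at i.+1 w - clock_at i w).
Proof.
rewrite clock_atS addrAC subrr add0r /stage_reward /act_part /rate_part.
case: ifP => _; last by rewrite mul0r addr0.
by rewrite /=; case: (w i).1 => [a|d] /=; rewrite ?mul0r ?addr0 ?add0r.
Qed.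

Let stage_reward_digitize u i w : stage_reward NO (digitize_run u w) i =
  act_part i w + rate_part i w *
    ((Num.truncn (clock_at i.+1 w + u))%:R - (Num.truncn (clock_at i w + u))%:R).
Proof.
rewrite stage_reward_retime clock_atS /act_part /rate_part.
case: ifP => _; last by rewrite mul0r addr0.
case: (w i).1 => [a|d]; first by rewrite mul0r addr0.
rewrite add0r; congr (_ * _).
by rewrite /= /digital_delay natrB// le_truncn// lerD2r lerDl.
Qed.

Let measurable_parts i :
  [/\ measurable_fun [set: run_space (sem Treal)] (act_part i),
      measurable_fun [set: run_space (sem Treal)] (rate_part i),
      measurable_fun [set: run_space (sem Treal)] (clock_at i) &
      measurable_fun [set: run_space (sem Treal)] (clock_at i.+1)].
Proof.
split; apply: (@measurable_fun_prefix _ _ _ _ _ i.+1) => w w' H.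
- rewrite /act_part (@unhit_eq _ _ _ w w'); last by move=> j /ltnW; exact: H.
  rewrite /state_at (@run_prefix_eq _ _ w w') ?H//.
  by move=> j /ltnW; exact: H.
- rewrite /rate_part (@unhit_eq _ _ _ w w'); last by move=> j /ltnW; exact: H.
  rewrite /state_at (@run_prefix_eq _ _ w w') ?H//.
  by move=> j /ltnW; exact: H.
- rewrite /clock_at (@run_prefix_eq _ _ w w')//.
  by move=> j /ltnW; exact: H.
- by rewrite /clock_at (@run_prefix_eq _ _ w w').
Qed.

Let digitized_reward (x : R * run_space (sem Treal)) : \bar R :=
  reach_reward NO (digitize_run x.1 x.2).

Let measurable_digitized_reward :
  measurable_fun [set: R * run_space (sem Treal)] digitized_reward.
Proof.
rewrite /digitized_reward; under eq_fun do rewrite reach_rewardE.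
apply: emeasurable_funD; last first.
  under eq_fun do rewrite miss_penalty_retime.
  exact: (measurableT_comp (measurable_miss_penalty RO) measurable_snd).
apply: ge0_emeasurable_sum.
  by move=> k w _ _; rewrite lee_fin stage_reward_ge0.
move=> i _; apply/measurable_EFinP.
under eq_fun do rewrite stage_reward_digitize.
have [ma mr mc mc'] := measurable_parts i.
have mt (c : run_space (sem Treal) -> R) : measurable_fun setT c ->
    measurable_fun [set: R * run_space (sem Treal)]
      (fun x => ((Num.truncn (c x.2 + x.1))%:R : R)).
  move=> mc0; apply: (measurableT_comp (@measurable_truncn R)).
  apply: measurable_funD; last exact: measurable_fst.
  exact: (measurableT_comp mc0 measurable_snd).
apply: measurable_funD; first exact: (measurableT_comp ma measurable_snd).
apply: measurable_funM; first exact: (measurableT_comp mr measurable_snd).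
by apply: measurable_funB; exact: mt.
Qed.

(** For a fixed run the integral passes through the series; each stage is affine in rounded times,
    whose means are exact, and the penalty does not depend on the shift. *)
Let integral_digitized_reward w :
  (\int[lebesgue_measure]_(u in `[0%R, 1%R[) digitized_reward (u, w))%E =
  reach_reward RO w.
Proof.
rewrite /digitized_reward reach_rewardE.
under eq_integral do rewrite reach_rewardE miss_penalty_retime.
have ms i : measurable_fun (`[0%R, 1%R[ : set R)
    (fun u : R => (stage_reward NO (digitize_run u w) i)%:E).
  apply: measurable_funTS; apply/measurable_EFinP.
  under eq_fun do rewrite stage_reward_digitize.
  apply: measurable_funD => //; apply: measurable_funM => //.
  apply: measurable_funB; apply: (measurableT_comp (@measurable_truncn R));
    exact: measurable_funD.
rewrite ge0_integralD//=; last 3 first.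
- by move=> u _; apply: nneseries_ge0 => i _ _; rewrite lee_fin stage_reward_ge0.
- apply: ge0_emeasurable_sum; last by move=> i _; exact: ms.
  by move=> i u _ _; rewrite lee_fin stage_reward_ge0.
- by move=> u _; exact: miss_penalty_ge0.
congr (_ + _)%E.
  rewrite integral_nneseries//; last first.
    by move=> i u _; rewrite lee_fin stage_reward_ge0.
  apply: eq_eseriesr => i _; rewrite stage_rewardE -integral_truncn_sub//.
    by apply: eq_integral => u _; rewrite stage_reward_digitize.
  by rewrite clock_at_ge0 clock_at_le.
rewrite integral_cst//= lebesgue_measure_itv/= lte_fin ltr01.
by rewrite -EFinB subr0 mule1.
Qed.

Variable mu : probability (run_space (sem_R P)) R.

Lemma measurable_integral_digitize : measurable_fun (`[0%R, 1%R[ : set R)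
  (fun u : R => \int[mu]_w reach_reward NO (digitize_run u w))%E.
Proof.
apply: measurable_funTS.
apply: (@measurable_fun_fubini_tonelli_F _ _ _ _ _ mu _
  measurable_digitized_reward) => x.
exact: reach_reward_ge0.
Qed.

Lemma integral_digitize :
  (\int[lebesgue_measure]_(u in `[0%R, 1%R[)
     \int[mu]_w reach_reward NO (digitize_run u w) =
   \int[mu]_w reach_reward RO w)%E.
Proof.
(* Tonelli is applied over the whole line, so the reward is extended by zero outside [0, 1[. *)
pose G (x : R * run_space (sem Treal)) : \bar R :=
  if x.1 \in `[0%R, 1%R[%R then digitized_reward x else 0%E.
have mG : measurable_fun setT G.
  apply: measurable_fun_ifT => //.
  apply: (measurable_fun_bool true); rewrite setTI.
  rewrite (_ : _ @^-1` _ = fst @^-1` (`[0%R, 1%R[%classic : set R))//.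
  by rewrite -[X in measurable X]setTI; apply: measurable_fst.
rewrite integral_mkcond.
transitivity (\int[lebesgue_measure]_u \int[mu]_w G (u, w))%E.
  apply: eq_integral => u _; rewrite /patch mem_setE /G /=.
  by case: ifP => // _; rewrite integral0.
rewrite fubini_tonelli//; last first.
  by move=> x; rewrite /G; case: ifP => // _; exact: reach_reward_ge0.
apply: eq_integral => w _; rewrite -integral_digitized_reward.
rewrite [RHS]integral_mkcond.
by apply: eq_integral => u _; rewrite /patch mem_setE /G /=.
Qed.

End averaging.

(** The interval has measure one, so [a] and [b] are their own integrals over it. *)
Lemma integral_unit_bounds (R : realType) (g : R -> \bar R) (a b : \bar R) :
  measurable_fun (`[0%R, 1%R[ : set R) g -> (0 <= a)%E ->
  (forall u, 0 <= u < 1 -> (a <= g u <= b)%E) ->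
  (a <= \int[lebesgue_measure]_(u in `[0%R, 1%R[) g u <= b)%E.
Proof.
move=> mg a0 gab.
have cstE (c : \bar R) :
    c = (\int[lebesgue_measure]_(u in `[0%R, 1%R[ : set R) cst c u)%E.
  rewrite integral_cst//= lebesgue_measure_itv/= lte_fin ltr01.
  by rewrite -EFinB subr0 mule1.
rewrite [X in (X <= _)%E]cstE [X in (_ <= _ <= X)%E]cstE; apply/andP; split.
  by apply: ge0_le_integral => // u; rewrite /= in_itv/= => /gab/andP[].
apply: ge0_le_integral => // u; rewrite /= in_itv/= => /gab/andP[] //.
by move=> /(le_trans a0).
Qed.

Lemma reach_reward_real (R : realType) (P : popta R) (O : {set locobs P})
    (w : run (sem_N P)) :
  reach_reward (obs_target O)
    (retime_run (T := digital_time P) (T' := real_time R (clock P))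
      (@real_delay R) w) =
  reach_reward (obs_target O) w.
Proof.
rewrite !reach_rewardE miss_penalty_retime; congr (_ + _)%E.
apply: eq_eseriesr => i _; congr EFin; rewrite stage_reward_retime /stage_reward.
by case: ifP => // _ /=; case: (w i).1.
Qed.

(** * Equality of the optimal values *)

Section values.
Variables (R : realType) (M : pomdp R) (O : set (pomdp_obsT M)).

Definition reach_values : set (\bar R) := [set p : \bar R |
  exists (sigma : fpath M -> pomdp_act M -> R)
         (mu : probability (run_space M) R),
    [/\ is_strategy sigma, observation_based sigma, induced_measure sigma mu
      & p = mu (reach_event O)]].

Definition reward_values : set (\bar R) := [set e : \bar R |
  exists (sigma : fpath M -> pomdp_act M -> R)
         (mu : probability (run_space M) R),
    [/\ is_strategy sigma, observation_based sigma, induced_measure sigma mu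
      & e = (\int[mu]_w reach_reward O w)%E]].

Lemma reward_values_ge0 e : reward_values e -> (0 <= e)%E.
Proof.
move=> [sigma [mu [_ _ _ ->]]].
by apply: integral_ge0 => w _; exact: reach_reward_ge0.
Qed.

End values.

Section equivalence.
Variables (R : realType) (P : popta R) (O : {set locobs P}).
Hypotheses (wfP : well_formed P) (closedP : closed_popta P)
  (diagP : diagonal_free P) (resP : resets_nonzero P).
Local Notation RO := (@obs_target R P (real_time R (clock P)) O).
Local Notation NO := (@obs_target R P (digital_time P) O).

Lemma reach_values_eq :
  @reach_values R (sem_R P) RO = @reach_values R (sem_N P) NO.
Proof.
apply/seteqP; split=> p [sigma [mu [st ob im ->]]].
  (* Any shift in [0, 1[ would do, since retiming keeps the targets visited. *)
  have u0 : 0 <= (0 : R) < 1 by rewrite lexx ltr01.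
  have [sigma' [mu' [st' ob' im' muE _]]] :=
    digitize_transfer wfP closedP diagP resP u0 st ob im.
  exists sigma', mu'; split=> //.
  by rewrite muE reach_event_retime.
have [sigma' [mu' [st' ob' im' muE _]]] :=
  real_transfer wfP closedP diagP resP st ob im.
exists sigma', mu'; split=> //.
by rewrite muE reach_event_retime.
Qed.

Lemma reward_values_sub :
  @reward_values R (sem_N P) NO `<=` @reward_values R (sem_R P) RO.
Proof.
move=> p [sigma [mu [st ob im ->]]].
have [sigma' [mu' [st' ob' im' _ muI]]] :=
  real_transfer wfP closedP diagP resP st ob im.
exists sigma', mu'; split=> //.
rewrite muI; first by apply: eq_integral => w _; rewrite reach_reward_real.
  exact: measurable_reach_reward.
exact: reach_reward_ge0.
Qed.

(** The dense reward is the average over [u] of the integrals of digitized rewards, each of which is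
    the value of a digital strategy. *)
Lemma reward_values_between e : @reward_values R (sem_R P) RO e ->
  (ereal_inf (@reward_values R (sem_N P) NO) <= e <=
   ereal_sup (@reward_values R (sem_N P) NO))%E.
Proof.
move=> [sigma [mu [st ob im ->]]].
rewrite -integral_digitize; apply: integral_unit_bounds.
- exact: measurable_integral_digitize.
- by apply: le_ereal_inf_tmp => x /reward_values_ge0.
move=> u u01.
have [sigma' [mu' [st' ob' im' _ muI]]] :=
  digitize_transfer wfP closedP diagP resP u01 st ob im.
have V : @reward_values R (sem_N P) NO
    (\int[mu]_w reach_reward NO (@digitize_run R P u w))%E.
  exists sigma', mu'; split=> //; rewrite muI//.
    exact: measurable_reach_reward.
  exact: reach_reward_ge0.
by rewrite ereal_inf_lbound// ereal_sup_ubound.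
Qed.

End equivalence.

Theorem theorem1 (R : realType) (P : popta R) (O : {set locobs P}) (o : opt) :
  well_formed P -> closed_popta P -> diagonal_free P -> resets_nonzero P ->
  @Pr_opt R o (sem_R P) (obs_target O) = @Pr_opt R o (sem_N P) (obs_target O) /\
  @E_opt R o (sem_R P) (obs_target O) = @E_opt R o (sem_N P) (obs_target O).
Proof.
move=> wfP closedP diagP resP; split.
  congr (optimum o _); exact: reach_values_eq.
rewrite /E_opt -!/(reward_values _).
have sub := reward_values_sub (O := O) wfP closedP diagP resP.
have bet := reward_values_between (O := O) wfP closedP diagP resP.
(* For each optimum, one inequality comes from the inclusion of the digital values among the dense
   ones, the other from the averaging bounds. *)
apply/eqP; rewrite eq_le; case: o => /=; apply/andP; split.
- exact: ereal_inf_le_tmp.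
- by apply: le_ereal_inf_tmp => e /bet/andP[].
- by apply: ge_ereal_sup => e /bet/andP[].
- exact: ereal_sup_le.
Qed.
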